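(* Let $d\mu\equiv e^{-U}d\lambda$ be a probability measure on a nilpotent Lie group, let $X_1,\dots,X_k$ be the first-order differential operators (left-invariant fields) generating its Lie algebra, and let $V_j\equiv X_j-\frac12X_jU$. If the nilpotent Lie algebra is of second order, then, with $\Lambda_1\equiv(1+\Theta)^{1/2}$, $$\|\Lambda_1f\|_2^2\le2\left(\sum_{j,l\le k}\left(V_jV_lf,V_jV_lf\right)+\|f\|_2^2\right).$$
   Context: $\lambda$ is the Haar measure; $(\cdot,\cdot)$ and $\|\cdot\|_2$ are the scalar product and norm of $\mathbb{L}_2(\mu)$, and $X_jU$ in $V_j$ acts as a multiplication operator. One has $\mu(fV_jg)=-\mu((V_jf)g)$ and $[V_j,V_l]=[X_j,X_l]-\frac12([X_j,X_l]U)$. Put $\mathfrak{L}\equiv-\sum_{j=1}^kV_j^2$, a non-negative self-adjoint operator on $\mathbb{L}_2(\mu)$, and $\Theta\equiv\mathfrak{L}-\sum_{j,l\le k}[V_j,V_l]^2$. ''Of second order'' means that all commutators of three or more elements vanish, i.e. $[X_j,X_l]$ lies in the centre of the Lie algebra. $U$ is smooth and $f$ is sufficiently regular for all expressions to be defined. *)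

(* Defs.v *)
From HB Require Import structures.
From mathcomp Require Import all_boot all_order all_algebra.
From mathcomp Require Import all_classical all_reals all_analysis.
Import Order.TTheory GRing.Theory Num.Theory numFieldNormedType.Exports.

Set Implicit Arguments.
Unset Strict Implicit.
Unset Printing Implicit Defensive.

Local Open Scope classical_set_scope.
Local Open Scope ring_scope.

(* C^oo on the set A, which is open in every use below: all iterated
   directional derivatives exist and are continuous at every point of A. *)
Definition smooth_on (R : realType) (V W : normedModType R) (A : set V)
    (f : V -> W) : Prop :=
  forall (vs : seq V) (x : V), A x ->
    let g := foldr (fun v h => 'D_v h) f vs in
    {for x, continuous g} /\ forall v, derivable g x v.

(* Outside chart_dom and its image, chart_fun and chart_inv are irrelevant. *)
Record chart (G V : topologicalType) := Chart {
  chart_dom : set G;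
  chart_fun : G -> V;
  chart_inv : V -> G;
  _ : open chart_dom;
  _ : open (chart_fun @` chart_dom);
  _ : {in chart_dom, cancel chart_fun chart_inv};
  _ : {within chart_dom, continuous chart_fun};
  _ : {within chart_fun @` chart_dom, continuous chart_inv} }.

HB.mixin Record isManifold (R : realType) (n : nat) G of PointedTopological G := {
  atlas : set (chart G 'rV[R]_n);
  atlas_cover : forall x : G, exists2 c, atlas c & chart_dom c x;
  atlas_compat : forall c d, atlas c -> atlas d ->
    smooth_on (chart_fun c @` (chart_dom c `&` chart_dom d))
              (chart_fun d \o chart_inv c);
  manifold_hausdorff : hausdorff_space G;
  manifold_second_countable : @second_countable G }.

#[short(type="manifoldType")]
HB.structure Definition Manifold (R : realType) (n : nat) :=
  {G of PointedTopological G & isManifold R n G}.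

HB.mixin Record isLieGroup (R : realType) (n : nat) G
    of Group G & Manifold R n G := {
  lie_mulg_continuous : continuous (fun p : G * G => (p.1 * p.2)%g);
  lie_invg_continuous : continuous (fun x : G => (x^-1)%g);
  lie_mulg_smooth : forall c d e : chart G 'rV[R]_n,
    atlas c -> atlas d -> atlas e ->
    smooth_on [set p : 'rV[R]_n * 'rV[R]_n |
        [/\ (chart_fun c @` chart_dom c) p.1, (chart_fun d @` chart_dom d) p.2
          & chart_dom e (chart_inv c p.1 * chart_inv d p.2)%g]]
      (fun p => chart_fun e (chart_inv c p.1 * chart_inv d p.2)%g);
  lie_invg_smooth : forall c d : chart G 'rV[R]_n, atlas c -> atlas d ->
    smooth_on [set y | (chart_fun c @` chart_dom c) y /\
                       chart_dom d ((chart_inv c y)^-1)%g]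
      (fun y => chart_fun d ((chart_inv c y)^-1)%g) }.

#[short(type="lieGroupType")]
HB.structure Definition LieGroup (R : realType) (n : nat) :=
  {G of Group G & Manifold R n G & isLieGroup R n G}.

Notation borel G := (g_sigma_algebraType (@open G)).

Section Fields.
Context (R : realType) (n : nat) (G : lieGroupType R n).
Implicit Types (f : G -> R).

Definition smooth f : Prop :=
  forall c : chart G 'rV[R]_n, atlas c ->
    smooth_on (chart_fun c @` chart_dom c) (f \o chart_inv c).

Definition test_function f : Prop :=
  smooth f /\ compact (closure [set x | f x != 0]).

(* First-order operators are only meaningful on smooth functions: their values
   on other functions are unconstrained, and they are compared by op_eq. *)
Definition operator := (G -> R) -> (G -> R).
Implicit Types (X Y : operator).

Definition op_eq X Y : Prop := forall f, smooth f -> X f = Y f.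

Definition tangent_vector (x : G) (D : (G -> R) -> R) : Prop :=
  exists (c : chart G 'rV[R]_n) (v : 'rV[R]_n), [/\ atlas c, chart_dom c x
    & forall f, smooth f -> D f = 'D_v (f \o chart_inv c) (chart_fun c x)].

Definition vector_field X : Prop :=
  (forall x, tangent_vector x (fun f => X f x)) /\
  (forall f, smooth f -> smooth (X f)).

(* The elements of the Lie algebra of G. *)
Definition left_invariant_field X : Prop :=
  vector_field X /\
  forall (a : G) f, smooth f ->
    X (fun x => f (a * x)%g) = (fun x => X f (a * x)%g).

Definition bracket X Y : operator := fun f => X (Y f) \- Y (X f).

Definition lie_subalgebra (S : set operator) : Prop :=
  [/\ S (fun=> cst 0),
      forall (a : R) X Y, S X -> S Y -> S (fun f x => a * X f x + Y f x),
      forall X Y, S X -> S Y -> S (bracket X Y)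
    & forall X Y, op_eq X Y -> S X -> S Y].

Definition lie_generates (k : nat) (X : 'I_k -> operator) : Prop :=
  forall S, lie_subalgebra S -> (forall j, S (X j)) ->
    forall Y, left_invariant_field Y -> S Y.

(* [[..[Z_0, Z_1], ..], Z_m] *)
Fixpoint nested_bracket (Z : nat -> operator) (m : nat) : operator :=
  if m is m'.+1 then bracket (nested_bracket Z m') (Z m) else Z 0%N.

(* All commutators of m + 1 (hence of more) elements of the Lie algebra vanish. *)
Definition lie_nilpotent_of_order (m : nat) : Prop :=
  forall Z : nat -> operator, (forall i, left_invariant_field (Z i)) ->
    op_eq (nested_bracket Z m) (fun=> cst 0).

Definition nilpotent_lie_group : Prop :=
  connected [set: G] /\ exists m, lie_nilpotent_of_order m.

(* Nilpotent groups being unimodular, the Haar measure is two-sided; Radon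
   regularity is automatic, G being locally compact and second countable. *)
Definition haar_measure (lambda : {measure set (borel G) -> \bar R}) : Prop :=
  [/\ lambda setT != 0%E,
      forall K : set G, compact K -> (lambda K < +oo)%E
    & forall (A : set (borel G)) (a : G), measurable A ->
        lambda [set (a * x)%g | x in A] = lambda A /\
        lambda [set (x * a)%g | x in A] = lambda A].

Variables (k : nat) (X : 'I_k -> operator) (U : G -> R).

Definition V (j : 'I_k) : operator :=
  fun f x => X j f x - 2^-1 * X j U x * f x.

Definition frakL : operator := fun f x => - \sum_(j < k) V j (V j f) x.

Definition Theta : operator := fun f x =>
  frakL f x -
  \sum_(j < k) \sum_(l < k) bracket (V j) (V l) (bracket (V j) (V l) f) x.

End Fields.

Section L2.
Context d (T : measurableType d) (R : realType)
  (mu : {measure set T -> \bar R}).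
Implicit Types (f g h : T -> R).

Definition L2 f : Prop := f \in Lfun mu 2%:E.

Definition dot f g : R := \int[mu]_x (f x * g x).

Definition norm2 f : R := fine ('N[mu]_(2%:E) [EFin \o f]).

(* Unbounded operators on L_2(mu) are given by their graphs, relations between
   representatives of classes of functions equal almost everywhere. *)
Definition L2_operator := (T -> R) -> (T -> R) -> Prop.
Implicit Types (A B : L2_operator).

Definition densely_defined A : Prop :=
  forall f, L2 f -> forall e : R, 0 < e ->
    exists g h, [/\ L2 g, A g h & norm2 (f \- g) < e].

Definition adjoint A : L2_operator := fun f h =>
  [/\ L2 f, L2 h & forall f' h', A f' h' -> dot h f' = dot f h'].

(* An adjoint graph is linear, closed and stable under a.e. equality, and that
   of a densely defined operator is single-valued up to a.e. equality; so this
   equation subsumes these properties for A. *)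
Definition self_adjoint A : Prop :=
  densely_defined A /\ forall f h, A f h <-> adjoint A f h.

Definition nonnegative A : Prop := forall f h, A f h -> 0 <= dot f h.

Definition one_plus A : L2_operator := fun f h =>
  exists2 g, A f g & h = f \+ g.

Definition op_comp A B : L2_operator := fun f h => exists2 g, B f g & A g h.

(* B = A^(1/2), the unique non-negative self-adjoint operator with B^2 = A,
   domains included. *)
Definition is_sqrt_op B A : Prop :=
  [/\ self_adjoint B, nonnegative B
    & forall f h, op_comp B B f h <-> A f h].

End L2.

(* A is the operator on L_2(mu) defined by the differential expression D: a
   non-negative self-adjoint operator acting as D on test functions.  (For
   D = Theta on a Lie group there is exactly one: Theta is conjugate, by
   multiplication by e^(U/2), to a sum of squares of left-invariant fields,
   which is essentially self-adjoint on test functions.) *)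
Definition realizes (R : realType) (n : nat) (G : lieGroupType R n)
    (mu : {measure set (borel G) -> \bar R}) (D : operator G)
    (A : L2_operator (borel G) R) : Prop :=
  [/\ self_adjoint mu A, nonnegative mu A
    & forall f, test_function f -> A f (D f)].

(* Main.v *)
Require Import Defs.
From HB Require Import structures.
From mathcomp Require Import all_boot all_order all_algebra.
From mathcomp Require Import all_classical all_reals all_analysis.
From mathcomp Require Import measurable_realfun ring lra zify.
Import Order.TTheory GRing.Theory Num.Theory numFieldNormedType.Exports.

(** Conjugation by exp(U/2) turns the V_j into the left-invariant fields X_j;
    hence the V_j are skew-symmetric for the scalar product of L_2(mu) against
    test functions, and, the Lie algebra being of second order, the brackets
    Z_jl = [V_j, V_l] commute with all V_m.  For a test function g,
    integrations by parts give

      2 (V_j V_l g, V_l V_j g) = (V_l^2 g, V_j^2 g) + |V_j V_l g|^2,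

    so that sum_jl |Z_jl g|^2 = sum_jl |V_j V_l g|^2 - |L g|^2 with
    L = - sum_j V_j^2, and since (g, L g) <= (|g|^2 + |L g|^2) / 2,

      (g, (1 + Theta) g) <= 3/2 |g|^2 + sum_jl |V_j V_l g|^2

    (quadratic_form_le).  Here the skew-symmetry of V_j rests on the vanishing
    of the integral of X_j h against the Haar measure (haar_integral_field).

    A general f is truncated: there are compactly supported smooth chi_m with
    values in [0, 1], equal to 1 on larger and larger compact sets, whose first
    and second derivatives along the X_j are O(1/m) (cutoff_sequence).  They
    are averages of m + 1 plateau functions with disjoint transition regions
    and uniformly bounded derivatives, built from translates of one bump.  The
    first derivatives of f are controlled by cutoff_energy_le, and
    cutoff_second_derivative_le yields

      |Lambda_1 (chi_m f)|^2 = (chi_m f, (1 + Theta) chi_m f)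
        <= 2 (sum_jl |V_j V_l f|^2 + |f|^2) + O(1/m),

    where the factor 2 absorbs the cross terms of the Leibniz formula.  Finally,
    for p in the domain of Lambda_1,

      (Lambda_1 f, p) = (f, Lambda_1 p) = lim (chi_m f, Lambda_1 p)
                      = lim (Lambda_1 (chi_m f), p),

    and this domain is dense, so the bound passes to Lambda_1 f
    (dense_norm_le).  This argument only involves the self-adjointness of
    Lambda_1, the equation Lambda_1^2 = 1 + Theta and the action of Theta on
    test functions; it does not require Theta to be essentially self-adjoint
    on them. *)

Set Implicit Arguments.
Unset Strict Implicit.
Unset Printing Implicit Defensive.

Local Open Scope classical_set_scope.
Local Open Scope ring_scope.

(** * Calculus of directional derivatives *)

Section DirectionalDerivatives.
Context (R : realType) (V : normedModType R).
Implicit Types (f : V -> R) (x v : V).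

(** The derivative of f along v is that of its restriction to a line. *)
Lemma derive_lineE f x v : 'D_v f x = 'D_1 (fun s : R => f (s *: v + x)) 0.
Proof.
rewrite /derive; set g1 := fun h => _; set g2 := fun h => _.
suff -> : g1 = g2 by [].
by apply/funext => h; rewrite /g1 /g2 /= addr0 scale0r add0r [_%:A]mulr1.
Qed.

Lemma is_derive_scale f x v (c : R) :
  derivable f x v -> is_derive x (c *: v) f (c * 'D_v f x).
Proof.
move=> dfv.
pose F := fun s : R => f (s *: v + x); pose m := fun h : R => h * c.
have dm : is_derive (0 : R) 1 m c.
  have /is_derive_eq := @is_deriveM R R id (cst c) 0 1 1 0 (is_derive_id _ _) (is_derive_cst _ _ _).
  by apply; rewrite scaler0 add0r [_ *: _]mulr1.
have Fm : (fun h : R => f (h *: (c *: v) + x)) = F \o m.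
  by apply/funext => h /=; rewrite /F /m scalerA.
have dF : derivable F (m 0) 1 by rewrite /m mul0r; exact: (derivable1P f x v).1.
apply: DeriveDef; first apply: (derivable1P f x (c *: v)).2.
  rewrite Fm; apply/derivable1_diffP; apply: differentiable_comp.
    by apply/derivable1_diffP; exact: ex_derive.
  by apply/derivable1_diffP.
rewrite derive_lineE Fm -derive1E derive1_comp// !derive1E derive_val.
by rewrite /m mul0r mulrC derive_lineE.
Qed.

Lemma mean_value_direction f x v :
  (forall s : R, 0 <= s <= 1 -> derivable f (s *: v + x) v) ->
  exists2 s : R, 0 <= s <= 1 & f (v + x) - f x = 'D_v f (s *: v + x).
Proof.
move=> dfv; pose F := fun s : R => f (s *: v + x).
have shiftF s : (fun h : R => f (h *: v + (s *: v + x))) = F \o shift s.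
  by apply/funext => h /=; rewrite /F scalerDl addrA.
have dF (s : R) : 0 <= s <= 1 -> is_derive s 1 F ('D_v f (s *: v + x)).
  move=> s01; have := dfv _ s01 => /derivable1P dFs.
  apply: DeriveDef; last first.
    rewrite derive_lineE shiftF /derive; set g1 := fun h => _; set g2 := fun h => _.
    suff -> : g1 = g2 by [].
    by apply/funext => h; rewrite /g1 /g2 /= addr0 add0r.
  move: dFs; rewrite shiftF /derivable; set g1 := fun h => _; set g2 := fun h => _.
  suff -> : g1 = g2 by [].
  by apply/funext => h; rewrite /g1 /g2 /= addr0 add0r.
have cF : {within `[0, 1], continuous F}.
  by apply: derivable_within_continuous => s; rewrite in_itv/= => /dF[].
have [s|s s01] := MVT_segment (f := F) (df := fun s => 'D_v f (s *: v + x)) ler01 _ cF.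
  by rewrite in_itv/= => /andP[s0 s1]; apply: dF; rewrite !ltW.
by rewrite /F scale1r scale0r add0r subr0 mulr1 => ->; exists s.
Qed.

End DirectionalDerivatives.

Section ContinuouslyDifferentiable.
Context (R : realType) (n : nat).
Implicit Types (f : 'rV[R]_n -> R) (x v h : 'rV[R]_n).

Lemma rV_norm_coord h (i : 'I_n) : `|h ord0 i| <= `|h|.
Proof.
rewrite [leRHS]/Num.Def.normr/= mx_normrE.
exact: (le_bigmax _ (fun ij : 'I_1 * 'I_n => `|h ij.1 ij.2|) (ord0, i)).
Qed.

Lemma rV_norm_le h (r : R) : 0 <= r ->
  (forall i, `|h ord0 i| <= r) -> `|h| <= r.
Proof.
move=> r0 hr; rewrite [leLHS]/Num.Def.normr/= mx_normrE bigmax_le// => -[i j] _.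
by rewrite /= ord1.
Qed.

(* The vector h with all coordinates from the k-th on replaced by 0. *)
Let trunc h (k : nat) : 'rV[R]_n := \row_i (if (i < k)%N then h ord0 i else 0).

(** First-order expansion of a function with continuous directional
    derivatives: its increment is a telescoping sum of increments along the
    coordinate axes, to each of which the mean value theorem applies. *)
Lemma C1_increment f x (e : R) : 0 < e ->
    (\forall y \near x, forall v, derivable f y v) ->
    (forall v, {for x, continuous ('D_v f)}) ->
  \forall h \near (0 : 'rV[R]_n),
    `|f (h + x) - f x - \sum_(i < n) h ord0 i * 'D_(delta_mx ord0 i) f x|
      <= e * `|h|.
Proof.
move=> e0 dfx cfx.
pose d := e / n.+1%:R.
have d0 : 0 < d by rewrite divr_gt0.
have : \forall y \near x, (forall v, derivable f y v) /\
    forall i : 'I_n, `|'D_(delta_mx ord0 i) f x - 'D_(delta_mx ord0 i) f y| <= d.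
  apply: filterI => //.
  have cfi (i : 'I_n) : \forall y \near x,
      `|'D_(delta_mx ord0 i) f x - 'D_(delta_mx ord0 i) f y| <= d.
    by have /cvgrPdist_le/(_ _ d0) := cfx (delta_mx ord0 i).
  exact: filter_forall cfi.
move=> /nbhs_ballP[r /= r0 xr].
have nearx z : `|z| < r -> (forall v, derivable f (z + x) v) /\
    forall i : 'I_n, `|'D_(delta_mx ord0 i) f x - 'D_(delta_mx ord0 i) f (z + x)| <= d.
  by move=> zr; apply: xr; rewrite -ball_normE/= opprD addrCA subrr addr0 normrN.
near=> h.
have hr : `|h| < r.
  by near: h; apply/nbhs_ballP; exists r => //= z; rewrite -ball_normE/= sub0r normrN.
have truncr k : `|trunc h k| <= `|h|.
  apply: rV_norm_le => // i; rewrite mxE; case: ifP => _; last by rewrite normr0.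
  exact: rV_norm_coord.
have step (k : 'I_n) : trunc h k.+1 = h ord0 k *: delta_mx ord0 k + trunc h k.
  apply/rowP => i; rewrite !mxE eqxx/= ltnS leq_eqVlt.
  have [->|ik] := eqVneq i k; first by rewrite eqxx ltnn mulr1 addr0.
  by rewrite (_ : (_ == _ :> nat) = false) ?mulr0 ?add0r//; apply/negbTE.
have -> : f (h + x) - f x = \sum_(i < n) (f (trunc h i.+1 + x) - f (trunc h i + x)).
  rewrite -(big_mkord xpredT (fun i => f (trunc h i.+1 + x) - f (trunc h i + x))).
  rewrite telescope_sumr//; congr (f (_ + _) - f _); apply/rowP => i.
    by rewrite mxE ltn_ord.
  by rewrite !mxE add0r.
rewrite -sumrB (le_trans (ler_norm_sum _ _ _))//.
rewrite [leRHS](_ : _ = n.+1%:R * (d * `|h|)); last first.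
  by rewrite mulrA; congr (_ * _); rewrite /d mulrC divfK.
apply: (@le_trans _ _ (\sum_(i < n) (d * `|h|))); last first.
  rewrite sumr_const card_ord -[leLHS]mulr_natl.
  by apply: ler_wpM2r; rewrite ?ler_nat// mulr_ge0// ltW.
apply: ler_sum => i _; rewrite step -[_ + _ + x]addrA.
have [s s01|s s01 ->] := @mean_value_direction R _ f (trunc h i + x)
    (h ord0 i *: delta_mx ord0 i).
  rewrite addrA; apply: (nearx _ _).1; apply: le_lt_trans hr.
  apply: rV_norm_le => // j; rewrite !mxE eqxx/= ltn_neqAle.
  have [->|ji] := eqVneq j i.
    rewrite eqxx/= addr0 mulr1 normrM (le_trans _ (rV_norm_coord h i))//.
    by case/andP: s01 => s0 s1; rewrite ger0_norm// ler_piMl.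
  rewrite mulr0 mulr0 add0r; case: ifP => _; last by rewrite normr0.
  exact: rV_norm_coord.
have sr : `|s *: (h ord0 i *: delta_mx ord0 i) + trunc h i| < r.
  apply: le_lt_trans hr.
  apply: rV_norm_le => // j; rewrite !mxE eqxx/= ltn_neqAle.
  have [->|ji] := eqVneq j i.
    rewrite eqxx/= addr0 mulr1 normrM (le_trans _ (rV_norm_coord h i))//.
    by case/andP: s01 => s0 s1; rewrite ger0_norm// ler_piMl.
  rewrite mulr0 mulr0 add0r; case: ifP => _; last by rewrite normr0.
  exact: rV_norm_coord.
rewrite addrA; have [dfs cfs] := nearx _ sr.
have [_ ->] := is_derive_scale (h ord0 i) (dfs (delta_mx ord0 i)).
rewrite -mulrBr normrM mulrC ler_pM// ?rV_norm_coord//.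
by rewrite distrC; exact: cfs.
Unshelve. all: by end_near. Qed.

End ContinuouslyDifferentiable.

Lemma C1_differentiable (R : realType) (n : nat) (f : 'rV[R]_n -> R) x :
    (\forall y \near x, forall v, derivable f y v) ->
    (forall v, {for x, continuous ('D_v f)}) ->
  differentiable f x.
Proof.
move=> dfx cfx.
pose L (h : 'rV[R]_n) : R := \sum_(i < n) h ord0 i * 'D_(delta_mx ord0 i) f x.
have Llin : linear L.
  move=> a u v; rewrite /L scaler_sumr -big_split/=.
  by apply: eq_bigr => i _; rewrite !mxE mulrDl -mulrA.
pose L' : {linear 'rV[R]_n -> R} := HB.pack L (GRing.isLinear.Build _ _ _ _ _ Llin).
have Lc : continuous L'.
  apply: (@continuous_big R 'I_n +%R 0 xpredT); [exact: add_continuous|move=> i _ h].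
  apply: (cvgM (FF := nbhs_filter h)); [exact: coord_continuous|exact: cvg_cst].
have fL : f \o shift x = cst (f x) + L' +o_ (nbhs 0) id.
  apply/eqaddoP => _/posnumP[e]; rewrite /= near_simpl.
  apply: filterS (C1_increment [gt0 of e%:num] dfx cfx) => h /=.
  by rewrite opprD addrA.
have dE := diff_unique Lc fL.
by apply/diff_locallyP; rewrite dE; split.
Qed.

Lemma is_derive_chain (R : realType) (V : normedModType R) (n : nat)
    (f : 'rV[R]_n -> R) (g : V -> 'rV[R]_n) x v :
    (\forall y \near g x, forall v, derivable f y v) ->
    (forall v, {for g x, continuous ('D_v f)}) ->
    derivable g x v ->
  is_derive x v (f \o g)
    (\sum_(i < n) 'D_v (fun y => g y ord0 i) x * 'D_(delta_mx ord0 i) f (g x)).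
Proof.
move=> dfx cfx dg; have df := C1_differentiable dfx cfx.
pose c := fun s : R => g (s *: v + x).
have c0 : c 0 = g x by rewrite /c scale0r add0r.
have dc : differentiable c 0 by apply/derivable1_diffP; exact: (derivable1P g x v).1.
have dfc : differentiable f (c 0) by rewrite c0.
have dcomp : differentiable (f \o c) 0 by exact: differentiable_comp.
apply: DeriveDef; first by apply: (derivable1P (f \o g) x v).2; apply/derivable1_diffP.
rewrite derive_lineE -/(f \o c) deriveE// (diff_comp dc dfc) [LHS]/= c0.
have -> : 'd c 0 1 = 'D_1 c 0 by rewrite deriveE.
have -> : 'D_1 c 0 = \sum_(i < n) 'D_v (fun y => g y ord0 i) x *: delta_mx ord0 i.
  rewrite [LHS](_ : _ = 'D_v g x).
    rewrite derive_mx// [LHS]row_sum_delta.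
    by apply: eq_bigr => i _; rewrite mxE.
  rewrite /derive; set g1 := fun h => _; set g2 := fun h => _.
  suff -> : g1 = g2 by [].
  by apply/funext => h; rewrite /g1 /g2 /= addr0 /c scale0r add0r [_%:A]mulr1.
rewrite linear_sum/=; apply: eq_bigr => i _.
by rewrite linearZ/= -deriveE.
Qed.

(** * Functions of class C^k *)

(** The functions of class C^k on a set, which is open in every use below. *)
Fixpoint Ck (R : realType) (V W : normedModType R) (k : nat) (A : set V)
    (f : V -> W) : Prop :=
  (forall x, A x -> {for x, continuous f}) /\
  if k is k'.+1 then forall v, (forall x, A x -> derivable f x v) /\
                               Ck k' A ('D_v f)
  else True.

Section CkTheory.
Context (R : realType) (V : normedModType R).
Implicit Types (A B : set V) (k : nat).

Lemma smooth_on_derive (W : normedModType R) A (f : V -> W) v :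
  smooth_on A f -> smooth_on A ('D_v f).
Proof.
by move=> sf vs x Ax; have := sf (rcons vs v) x Ax; rewrite foldr_rcons.
Qed.

(** Smoothness is being of class C^k for all k; the closure properties below
    are proved by induction on k. *)
Lemma smooth_onP (W : normedModType R) A (f : V -> W) :
  smooth_on A f <-> forall k, Ck k A f.
Proof.
split=> [sf k|cf vs].
  elim: k f sf => [|k IH] f sf.
    by split=> // x Ax; have [] := sf [::] x Ax.
  split=> [x Ax|v]; first by have [] := sf [::] x Ax.
  split=> [x Ax|]; first by have [_] := sf [::] x Ax; exact.
  exact/IH/smooth_on_derive.
elim/last_ind: vs f cf => [|vs v IH] f cf x Ax /=.
  have [c d] := cf 1%N; split; first exact: c.
  by move=> v; apply: (d v).1.
rewrite foldr_rcons; apply: IH => // k.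
by have [_ /(_ v)[]] := cf k.+1.
Qed.

Lemma Ck_continuous (W : normedModType R) A k (f : V -> W) x :
  Ck k A f -> A x -> {for x, continuous f}.
Proof. by case: k => [|k] [c _]; exact: c. Qed.

Lemma Ck_derivable (W : normedModType R) A k (f : V -> W) x v :
  Ck k.+1 A f -> A x -> derivable f x v.
Proof. by case=> _ /(_ v)[+ _]; exact. Qed.

Lemma Ck_derive (W : normedModType R) A k (f : V -> W) v :
  Ck k.+1 A f -> Ck k A ('D_v f).
Proof. by case=> _ /(_ v)[]. Qed.

Lemma CkS (W : normedModType R) A k (f : V -> W) : Ck k.+1 A f -> Ck k A f.
Proof.
elim: k f => [|k IH] f [c d]; first by split.
split=> // v; by have [dv cv] := d v; split=> //; exact: IH.
Qed.

Lemma Ck_subset (W : normedModType R) A B k (f : V -> W) :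
  A `<=` B -> Ck k B f -> Ck k A f.
Proof.
move=> AB; elim: k f => [|k IH] f [c d]; first by split=> // x /AB/c.
split=> [x /AB/c//|v]; by have [dv cv] := d v; split=> [x /AB/dv//|]; exact: IH.
Qed.

Lemma Ck_eq (W : normedModType R) A k (f g : V -> W) : open A ->
  (forall x, A x -> f x = g x) -> Ck k A f -> Ck k A g.
Proof.
move=> oA; elim: k f g => [|k IH] f g fg [c d].
  split=> // x Ax.
  have fgx : {near x, f =1 g} by apply: filterS (open_nbhs_nbhs (conj oA Ax)).
  rewrite /prop_for /continuous_at -(fg _ Ax).
  by apply: cvg_trans (c _ Ax); apply: near_eq_cvg; exact: filterS fgx => y ->.
have fgx x : A x -> {near x, f =1 g}.
  by move=> Ax; apply: filterS (open_nbhs_nbhs (conj oA Ax)).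
split=> [x Ax|v].
  rewrite /prop_for /continuous_at -(fg _ Ax).
  by apply: cvg_trans (c _ Ax); apply: near_eq_cvg; exact: filterS (fgx _ Ax) => y ->.
have [dv cv] := d v; split=> [x Ax|].
  exact: near_eq_derivable (fgx _ Ax) (dv _ Ax).
by apply: IH cv => x Ax; apply: near_eq_derive; exact: fgx.
Qed.

Lemma Ck_cst (W : normedModType R) A k (c : W) : Ck k A (cst c).
Proof.
elim: k c => [|k IH] c; first by split=> // x _; exact: cst_continuous.
split=> [x _|v]; first exact: cst_continuous.
split=> [x _|]; first exact: derivable_cst.
suff -> : 'D_v (cst c) = (cst 0 : V -> W) by exact: IH.
by apply/funext => x; rewrite derive_cst.
Qed.

Lemma Ck_add (W : normedModType R) A k (f g : V -> W) : open A ->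
  Ck k A f -> Ck k A g -> Ck k A (f \+ g).
Proof.
move=> oA; elim: k f g => [|k IH] f g [cf df] [cg dg].
  by split=> // x Ax; apply: continuousD; [exact: cf|exact: cg].
split=> [x Ax|v]; first by apply: continuousD; [exact: cf|exact: cg].
have [dfv cfv] := df v; have [dgv cgv] := dg v; split=> [x Ax|].
  by apply: derivableD; [exact: dfv|exact: dgv].
apply: Ck_eq (IH _ _ cfv cgv) => // x Ax.
by rewrite deriveD//; [exact: dfv|exact: dgv].
Qed.

Lemma Ck_mul A k (f g : V -> R) : open A ->
  Ck k A f -> Ck k A g -> Ck k A (f \* g).
Proof.
move=> oA; elim: k f g => [|k IH] f g Cf Cg; have [cf df] := Cf; have [cg dg] := Cg.
  by split=> // x Ax; apply: continuousM; [exact: cf|exact: cg].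
split=> [x Ax|v]; first by apply: continuousM; [exact: cf|exact: cg].
have [dfv cfv] := df v; have [dgv cgv] := dg v; split=> [x Ax|].
  by apply: derivableM; [exact: dfv|exact: dgv].
apply: Ck_eq (Ck_add oA (IH _ _ (CkS Cf) cgv) (IH _ _ (CkS Cg) cfv)) => // x Ax.
by rewrite deriveM//; [exact: dfv|exact: dgv].
Qed.

Lemma Ck_sum (W : normedModType R) A k (I : Type) (r : seq I) (F : I -> V -> W) :
  open A -> (forall i, Ck k A (F i)) -> Ck k A (fun x => \sum_(i <- r) F i x).
Proof.
move=> oA CF; elim: r => [|i r IH].
  suff -> : (fun x => \sum_(i <- [::]) F i x) = cst 0 by exact: Ck_cst.
  by apply/funext => x; rewrite big_nil.
suff -> : (fun x => \sum_(j <- i :: r) F j x) =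
          F i \+ (fun x => \sum_(j <- r) F j x) by exact: Ck_add.
by apply/funext => x; rewrite big_cons.
Qed.

Lemma Ck_prod A k (I : Type) (r : seq I) (F : I -> V -> R) :
  open A -> (forall i, Ck k A (F i)) -> Ck k A (fun x => \prod_(i <- r) F i x).
Proof.
move=> oA CF; elim: r => [|i r IH].
  suff -> : (fun x => \prod_(i <- [::]) F i x) = cst 1 by exact: Ck_cst.
  by apply/funext => x; rewrite big_nil.
suff -> : (fun x => \prod_(j <- i :: r) F j x) =
          F i \* (fun x => \prod_(j <- r) F j x) by exact: Ck_mul.
by apply/funext => x; rewrite big_cons.
Qed.

Lemma Ck_coord A k n (g : V -> 'rV[R]_n) (i : 'I_n) :
  open A -> Ck k A g -> Ck k A (fun x => g x ord0 i).
Proof.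
move=> oA; elim: k g => [|k IH] g [cg dg].
  split=> // x Ax; apply: (@continuous_comp _ _ _ g (fun M : 'rV[R]_n => M ord0 i)).
    exact: cg.
  exact: coord_continuous.
split=> [x Ax|v].
  apply: (@continuous_comp _ _ _ g (fun M : 'rV[R]_n => M ord0 i)).
    exact: cg.
  exact: coord_continuous.
have [dv cv] := dg v; split=> [x Ax|].
  by have /derivable_mxP := dv x Ax; exact.
by apply: Ck_eq (IH _ cv) => // x Ax; rewrite derive_mx ?mxE//; exact: dv.
Qed.

End CkTheory.

Section CkComposition.
Context (R : realType) (V : normedModType R).
Implicit Types (A : set V) (k : nat).

(** The chain rule expresses the derivatives of f \o g by products of
    derivatives of g and of partial derivatives of f composed with g, which
    are of class C^k by induction. *)
Lemma Ck_comp n A (B : set 'rV[R]_n) k (f : 'rV[R]_n -> R) (g : V -> 'rV[R]_n) :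
  open A -> open B -> (forall x, A x -> B (g x)) ->
  Ck k B f -> Ck k A g -> Ck k A (f \o g).
Proof.
move=> oA oB gAB; elim: k f => [|k IH] f Cf Cg.
  split=> // x Ax; apply: continuous_comp; first exact: Ck_continuous Cg Ax.
  exact: Ck_continuous Cf (gAB _ Ax).
split=> [x Ax|v].
  apply: continuous_comp; first exact: Ck_continuous Cg Ax.
  exact: Ck_continuous Cf (gAB _ Ax).
have chain x : A x -> is_derive x v (f \o g)
   (\sum_(i < n) 'D_v (fun y => g y ord0 i) x * 'D_(delta_mx ord0 i) f (g x)).
  move=> Ax; apply: is_derive_chain.
  - apply: filterS (open_nbhs_nbhs (conj oB (gAB _ Ax))) => y By w.
    exact: Ck_derivable Cf By.
  - by move=> w; exact: Ck_continuous (Ck_derive w Cf) (gAB _ Ax).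
  - exact: Ck_derivable Cg Ax.
split=> [x /chain[]//|].
pose F (i : 'I_n) x := 'D_v (fun y => g y ord0 i) x * 'D_(delta_mx ord0 i) f (g x).
have CF i : Ck k A (F i).
  apply: Ck_mul => //; last exact: IH (Ck_derive _ Cf) (CkS Cg).
  exact: Ck_derive (Ck_coord i oA Cg).
by apply: Ck_eq (Ck_sum _ oA CF) => // x /chain[_ ->].
Qed.

Lemma is_derive_comp1 (f : R -> R) (u : V -> R) x v :
  derivable f (u x) 1 -> derivable u x v ->
  is_derive x v (f \o u) ('D_v u x * 'D_1 f (u x)).
Proof.
move=> df du; pose c := fun s : R => u (s *: v + x).
have c0 : c 0 = u x by rewrite /c scale0r add0r.
have dc : derivable c 0 1 by exact: (derivable1P u x v).1.
have dfc : derivable f (c 0) 1 by rewrite c0.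
apply: DeriveDef.
  apply: (derivable1P (f \o u) x v).2; apply/derivable1_diffP.
  apply: (@differentiable_comp R R R R c f 0).
    exact: (derivable1_diffP c 0).1.
  exact: (derivable1_diffP f (c 0)).1.
rewrite derive_lineE -/(f \o c) -derive1E derive1_comp// !derive1E c0 mulrC.
by rewrite [in RHS]derive_lineE.
Qed.

Lemma Ck_comp1 A (B : set R) k (f : R -> R) (u : V -> R) :
  open A -> (forall x, A x -> B (u x)) ->
  Ck k B f -> Ck k A u -> Ck k A (f \o u).
Proof.
move=> oA uAB; elim: k f => [|k IH] f Cf Cu.
  split=> // x Ax; apply: continuous_comp; first exact: Ck_continuous Cu Ax.
  exact: Ck_continuous Cf (uAB _ Ax).
split=> [x Ax|v].
  apply: continuous_comp; first exact: Ck_continuous Cu Ax.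
  exact: Ck_continuous Cf (uAB _ Ax).
have chain x : A x -> is_derive x v (f \o u) ('D_v u x * 'D_1 f (u x)).
  move=> Ax; apply: is_derive_comp1; first exact: Ck_derivable Cf (uAB _ Ax).
  exact: Ck_derivable Cu Ax.
split=> [x /chain[]//|].
have CM := Ck_mul oA (Ck_derive v Cu) (IH _ (Ck_derive (1 : R) Cf) (CkS Cu)).
apply: Ck_eq CM => //.
by move=> x /chain[_ ->].
Qed.

End CkComposition.

(** * Flat functions and bumps on R^n *)

Section FlatFunction.
Context (R : realType).
Implicit Types (x y : R) (k : nat).

(** The functions x^-k exp(-1/x) extended by 0 to x <= 0: they are all flat
    at 0, and differentiation only produces linear combinations of them. *)
Definition flat k x : R := if 0 < x then x^-1 ^+ k * expR (- x^-1) else 0.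

Lemma flat_ge0 k x : 0 <= flat k x.
Proof.
rewrite /flat; case: ifP => // x0.
by rewrite mulr_ge0 ?expR_ge0// exprn_ge0// invr_ge0 ltW.
Qed.

Lemma flat_le0 k x : x <= 0 -> flat k x = 0.
Proof. by move=> x0; rewrite /flat ltNge x0. Qed.

Lemma flat0_gt0 x : 0 < x -> 0 < flat 0 x.
Proof. by move=> x0; rewrite /flat x0 expr0 mul1r expR_gt0. Qed.

(** Hence flat k is differentiable at 0, with derivative 0. *)
Lemma flat_quadratic k x : flat k x <= k.+2%:R ^+ k.+2 * x ^+ 2.
Proof.
have [x0|x0] := ltP 0 x; last by rewrite flat_le0// mulr_ge0 ?sqr_ge0// exprn_ge0.
rewrite /flat x0; set m := k.+2; have m0 : 0 < m%:R :> R by rewrite ltr0n.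
have ey : (x^-1 / m%:R) ^+ m <= expR (x^-1).
  have -> : expR (x^-1) = expR (x^-1 / m%:R) ^+ m.
    by rewrite -expRM_natl mulrC divfK// gt_eqF.
  (* exp y = exp (y / m) ^ m >= (y / m) ^ m with m = k + 2 *)
  have yn : x^-1 / m%:R <= expR (x^-1 / m%:R).
    by rewrite (le_trans _ (expR_ge1Dx _))// lerDr.
  by apply: lerXn2r; rewrite ?nnegrE ?expR_ge0// divr_ge0// ?invr_ge0 ltW.
have ey' : expR (- x^-1) <= m%:R ^+ m * x ^+ m.
  rewrite expRN -[leRHS]invrK lef_pV2 ?posrE ?expR_gt0//; last first.
    by rewrite invr_gt0 mulr_gt0// exprn_gt0.
  by rewrite invfM -!exprVn mulrC -exprMn.
apply: (@le_trans _ _ (x^-1 ^+ k * (m%:R ^+ m * x ^+ m))).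
  by apply: ler_wpM2l ey'; rewrite exprn_ge0// invr_ge0 ltW.
rewrite mulrCA; apply: ler_wpM2l; first by rewrite exprn_ge0.
by rewrite /m -addn2 exprD mulrA -exprMn mulVf ?gt_eqF// expr1n mul1r.
Qed.

Lemma is_derive_flat k x :
  is_derive x 1 (flat k) (flat k.+2 x - k%:R * flat k.+1 x).
Proof.
have [x0|x0|->] := ltgtP x 0.
- apply: (@near_eq_is_derive _ _ _ (cst 0)); last first.
    by rewrite !flat_le0 ?ltW// mulr0 subr0; exact: is_derive_cst.
  near=> y; rewrite /= flat_le0// ltW//; near: y; exact: lt_nbhsl.
- apply: (@near_eq_is_derive _ _ _ (fun x => x^-1 ^+ k * expR (- x^-1))).
    near=> y; rewrite /flat ifT//; near: y; exact: lt_nbhsr.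
  rewrite /flat x0.
  have dinv : is_derive x 1 (fun y : R => y^-1) (- x ^- 2).
    have /is_derive_eq := @is_deriveV R id x 1 1 (lt0r_neq0 x0) (is_derive_id _ _).
    by apply; rewrite /= [_ *: _]mulr1.
  have dM := is_deriveM (is_deriveX k dinv)
    (is_derive1_comp (is_derive_expR _) (is_deriveN dinv)).
  have -> : (fun y : R => y^-1 ^+ k * expR (- y^-1)) =
      (fun y : R => y^-1) ^+ k * (expR \o - (fun y : R => y^-1)).
    by apply/funext => y; rewrite /= !fctE.
  apply: is_derive_eq dM _.
  rewrite /= !fctE /= -[x ^- 2]exprVn; set y := x^-1; set E := expR _.
  rewrite /GRing.scale /=.
  have -> : k%:R * y ^+ k.-1 * - y ^+ 2 = - (k%:R * y ^+ k.+1).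
    by case: (k) => [|k']; rewrite ?mul0r ?oppr0//= !exprS; ring.
  by rewrite !exprS; ring.
- rewrite !flat_le0// mulr0 subr0.
  have n0 : `|h| @[h --> (0 : R)^'] --> (0 : R).
    rewrite -[X in _ --> X](@normr0 _ R); apply: cvg_within_filter.
    exact: (@norm_continuous R R 0).
  have lim0 : (fun h : R => h^-1 *: ((flat k \o shift 0) (h *: 1) - flat k 0)) @ 0^' --> (0 : R).
    apply: (@squeeze_cvgr _ _ _ _ (fun h : R => - (k.+2%:R ^+ k.+2 * `|h|))
      (fun h => k.+2%:R ^+ k.+2 * `|h|)).
    - near=> h; have h0 : h != 0 by near: h; exact: nbhs_dnbhs_neq.
      rewrite -ler_norml /= addr0 [h *: 1]mulr1 [flat k 0]flat_le0// subr0.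
      rewrite normrZ normfV ler_pdivrMl ?normr_gt0// (ger0_norm (flat_ge0 _ _)).
      rewrite (le_trans (flat_quadratic _ _))// [leRHS]mulrCA -expr2 real_normK//.
      exact: num_real.
    - rewrite -[X in _ --> X]oppr0; apply: cvgN; rewrite -[X in _ --> X](mulr0 (k.+2%:R ^+ k.+2)).
      by apply: cvgMl_tmp; exact: n0.
    - rewrite -[X in _ --> X](mulr0 (k.+2%:R ^+ k.+2)).
      by apply: cvgMl_tmp; exact: n0.
  by apply: DeriveDef; [apply/cvg_ex; exists 0|exact: cvg_lim lim0].
Unshelve. all: by end_near. Qed.


Lemma derive_scale1 (f : R -> R) x v :
  derivable f x 1 -> is_derive x v f (v * 'D_1 f x).
Proof.
by move=> df; have := is_derive_scale v df; rewrite [_ *: _]mulr1.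
Qed.

Lemma Ck_flat j k (A : set R) : open A -> Ck j A (flat k).
Proof.
move=> oA; elim: j k => [|j IH] k.
  split=> // x _; apply: differentiable_continuous; apply/derivable1_diffP.
  by have [] := is_derive_flat k x.
split=> [x _|v].
  apply: differentiable_continuous; apply/derivable1_diffP.
  by have [] := is_derive_flat k x.
have D x := derive_scale1 v (@ex_derive _ _ _ _ _ _ _ (is_derive_flat k x)).
split=> [x _|]; first by have [] := D x.
have CD := Ck_mul oA (Ck_cst A j v)
  (Ck_add oA (IH k.+2) (Ck_mul oA (Ck_cst A j (- k%:R : R)) (IH k.+1))).
apply: Ck_eq CD => // x _; have [_ ->] := D x.
by have [_ ->] := is_derive_flat k x; rewrite /= /cst mulNr.
Qed.

Lemma Ck_inv j (A : set R) : open A -> (forall x, A x -> x != 0) ->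
  Ck j A (fun x : R => x^-1).
Proof.
move=> oA A0; elim: j => [|j IH]; first by split=> // x /A0 x0; exact: inv_continuous.
split=> [x /A0 x0|v]; first exact: inv_continuous.
have D x : A x -> is_derive x v (fun x : R => x^-1) (- v * (x^-1 * x^-1)).
  move=> Ax; have x0 := A0 _ Ax.
  have /is_derive_eq := @is_deriveV R id x v v x0 (is_derive_id _ _).
  by apply; rewrite -exprVn expr2 /GRing.scale/= mulNr mulrC mulNr.
split=> [x /D[]//|].
by apply: Ck_eq (Ck_mul oA (Ck_cst A j (- v)) (Ck_mul oA IH IH)) => // x /D[_ ->].
Qed.

(** A smooth function of a real variable with values in [0, 1], equal to 1 on
    [-1, 1] and to 0 outside ]-2, 2[. *)
Definition plateau x : R :=
  let s := (4 - x ^+ 2) / 3 in flat 0 s / (flat 0 s + flat 0 (1 - s)).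

Let denom_gt0 s : 0 < flat 0 s + flat 0 (1 - s).
Proof.
have [s0|s0] := ltP 0 s; first by rewrite ltr_pwDl ?flat0_gt0 ?flat_ge0.
by rewrite ltr_wpDl ?flat_ge0 ?flat0_gt0//; lra.
Qed.

Lemma plateau_ge0 x : 0 <= plateau x.
Proof. by rewrite /plateau divr_ge0 ?flat_ge0 ?ltW. Qed.

Lemma plateau_le1 x : plateau x <= 1.
Proof. by rewrite /plateau ler_pdivrMr// mul1r lerDl flat_ge0. Qed.

Lemma plateau1 x : `|x| <= 1 -> plateau x = 1.
Proof.
move=> x1; have x21 : x ^+ 2 <= 1 by rewrite -real_normK ?num_real// expr_le1.
rewrite /plateau (@flat_le0 _ (1 - _)); last lra.
by rewrite addr0 divff// gt_eqF// flat0_gt0//; lra.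
Qed.

Lemma plateau0 x : 2 <= `|x| -> plateau x = 0.
Proof.
move=> x2; have x24 : 4 <= x ^+ 2.
  rewrite -real_normK ?num_real// (_ : 4 = 2 ^+ 2); last by ring.
  by rewrite lerXn2r ?nnegrE.
by rewrite /plateau flat_le0 ?mul0r//; lra.
Qed.

Lemma Ck_id j (A : set R) : open A -> Ck j A (id : R -> R).
Proof.
move=> oA; case: j => [|j]; first by split=> // x _; exact: cvg_id.
split=> [x _|v]; first exact: cvg_id.
 split=> [x _|]; first exact: derivable_id.
by apply: Ck_eq (Ck_cst A j v) => // x _; rewrite derive_id.
Qed.

Lemma Ck_plateau j : Ck j setT plateau.
Proof.
have oT : open [set: R] by exact: openT.
have Cs : Ck j setT (fun x : R => (4 - x ^+ 2) / 3).
  have C0 := Ck_mul oT (Ck_add oT (Ck_cst setT j (4 : R)) (Ck_mul oT (Ck_cst setT j (-1 : R))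
    (Ck_mul oT (Ck_id j oT) (Ck_id j oT)))) (Ck_cst setT j (3^-1 : R)).
  by apply: Ck_eq C0 => // x _; rewrite /= /cst mulN1r expr2.
have C1s : Ck j setT (fun x : R => 1 - (4 - x ^+ 2) / 3).
  have C0 := Ck_add oT (Ck_cst setT j (1 : R)) (Ck_mul oT (Ck_cst setT j (-1 : R)) Cs).
  by apply: Ck_eq C0 => // x _; rewrite /= /cst mulN1r.
have Cf := Ck_comp1 oT (fun _ _ => I) (Ck_flat j 0 oT) Cs.
have Cg := Ck_comp1 oT (fun _ _ => I) (Ck_flat j 0 oT) C1s.
apply: Ck_mul => //; apply: (@Ck_comp1 _ _ _ [set y | 0 < y]) (Ck_add oT Cf Cg) => //.
  by move=> x _; exact: denom_gt0.
by apply: Ck_inv => [|x /lt0r_neq0//]; exact: open_gt.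
Qed.

End FlatFunction.

(** Smooth bump functions on R^n, as products of functions of one coordinate:
    the norm is the supremum norm. *)
Lemma bump_rV (R : realType) (n : nat) (a : 'rV[R]_n) (r : R) : 0 < r ->
  exists phi : 'rV[R]_n -> R, [/\ forall k, Ck k setT phi,
    forall y, 0 <= phi y <= 1,
    forall y, `|y - a| <= r -> phi y = 1
    & forall y, 2 * r <= `|y - a| -> phi y = 0].
Proof.
move=> r0.
pose c (i : 'I_n) (y : 'rV[R]_n) : R := r^-1 * (y ord0 i - a ord0 i).
exists (fun y => \prod_(i < n) plateau (c i y)); split=> [k|y|y ya|y ya].
- apply: Ck_prod => [|i]; first exact: openT.
  have oT : open [set: 'rV[R]_n] by exact: openT.
  have Cy : Ck k setT (fun y : 'rV[R]_n => y ord0 i).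
    case: k => [|k]; first by split=> // x _; exact: coord_continuous.
    split=> [x _|v]; first exact: coord_continuous.
    have D x : is_derive x v (fun y : 'rV[R]_n => y ord0 i) (v ord0 i).
      have did : derivable id x v by exact: derivable_id.
      apply: DeriveDef; first by have /derivable_mxP := did; exact.
      by have := derive_mx did; rewrite derive_id => /rowP/(_ i); rewrite mxE.
    split=> [x _|]; first by have [] := D x.
    by apply: Ck_eq (Ck_cst setT k (v ord0 i)) => // x _; have [_ ->] := D x.
  apply: (@Ck_comp1 R _ setT setT k (@plateau R) (c i) oT) => //.
    exact: Ck_plateau.
  exact: Ck_mul oT (Ck_cst setT k r^-1) (Ck_add oT Cy (Ck_cst setT k (- a ord0 i))).
- rewrite prodr_ge0/= => [|i _]; last exact: plateau_ge0.
  by rewrite prodr_ile1// => i _; rewrite plateau_ge0 plateau_le1.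
- rewrite big1// => i _; apply: plateau1; rewrite /c normrM gtr0_norm ?invr_gt0//.
  rewrite ler_pdivrMl// mulr1 (le_trans _ ya)//.
  by have := rV_norm_coord (y - a) i; rewrite !mxE.
- have y0 : `|y - a| != 0 by rewrite gt_eqF// (lt_le_trans _ ya)// mulr_gt0.
  have [[i j] ij] := mx_norm_neq0 y0.
  rewrite (bigD1 j)//= plateau0 ?mul0r// /c normrM gtr0_norm ?invr_gt0//.
  rewrite ler_pdivlMl// mulrC (le_trans ya)//.
  by rewrite [leLHS]ij !mxE !ord1.
Qed.

(** * Charts and smooth functions on a Lie group *)

Section Charts.
Context (G V : topologicalType).
Implicit Types (c : chart G V) (O : set G).

(** The image of a chart, an open set on which the chart is inverted. *)
Definition chart_range c : set V := chart_fun c @` chart_dom c.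

Lemma chart_dom_open c : open (chart_dom c).
Proof. by case: c. Qed.

Lemma chart_range_open c : open (chart_range c).
Proof. by case: c. Qed.

Lemma chart_funK c x : chart_dom c x -> chart_inv c (chart_fun c x) = x.
Proof. by case: c => D f g oD oR fK cf cg /= Dx; rewrite fK// inE. Qed.

Lemma chart_invK c y : chart_range c y -> chart_fun c (chart_inv c y) = y.
Proof. by move=> [x cx <-]; rewrite chart_funK. Qed.

Lemma chart_inv_dom c y : chart_range c y -> chart_dom c (chart_inv c y).
Proof. by move=> [x cx <-]; rewrite chart_funK. Qed.

Lemma chart_fun_range c x : chart_dom c x -> chart_range c (chart_fun c x).
Proof. by move=> cx; exists x. Qed.

Lemma chart_fun_continuous c x :
  chart_dom c x -> {for x, continuous (chart_fun c)}.
Proof.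
case: c => D f g oD oR fK cf cg /= Dx.
by move: cf; rewrite continuous_open_subspace// => /(_ x); apply; rewrite inE.
Qed.

Lemma chart_inv_continuous c y :
  chart_range c y -> {for y, continuous (chart_inv c)}.
Proof.
case: c => D f g oD oR fK cf cg /=; rewrite /chart_range/= => Dy.
have := cg; rewrite continuous_open_subspace// => /(_ y); apply.
by rewrite inE.
Qed.

Lemma chart_inv_nbhs c x O : chart_dom c x -> nbhs x O ->
  \forall y \near chart_fun c x, chart_range c y /\ O (chart_inv c y).
Proof.
move=> cx Ox; apply: filterI.
  exact: open_nbhs_nbhs (conj (chart_range_open c) (chart_fun_range cx)).
by apply: (chart_inv_continuous (chart_fun_range cx)); rewrite /= chart_funK.
Qed.

Lemma open_chart_inv c O : open O ->
  open [set y | chart_range c y /\ O (chart_inv c y)].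
Proof.
move=> oO; rewrite openE => y [cy Oy]; rewrite /interior -(chart_invK cy).
apply: chart_inv_nbhs; first exact: chart_inv_dom.
exact: open_nbhs_nbhs.
Qed.

End Charts.

Lemma open_preimage_on (S T : topologicalType) (A : set S) (f : S -> T) (O : set T) :
  open A -> (forall x, A x -> {for x, continuous f}) -> open O ->
  open [set x | A x /\ O (f x)].
Proof.
move=> oA cf oO; rewrite openE => x [Ax Ofx]; apply: filterI.
  exact: open_nbhs_nbhs.
by apply: (cf _ Ax); exact: open_nbhs_nbhs.
Qed.

Section SmoothFunctions.
Context (R : realType) (n : nat) (G : lieGroupType R n).
Implicit Types (f g : G -> R) (c d e : chart G 'rV[R]_n).

Lemma smooth_Ck f c k : smooth f -> atlas c ->
  Ck k (chart_range c) (f \o chart_inv c).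
Proof. by move=> sf ac; move: k; apply/smooth_onP; exact: sf. Qed.

Lemma smooth_Ckl f : (forall c k, atlas c ->
  Ck k (chart_range c) (f \o chart_inv c)) -> smooth f.
Proof. by move=> Cf c ac; apply/smooth_onP => k; exact: Cf. Qed.

Lemma smooth_continuous f : smooth f -> continuous f.
Proof.
move=> sf x; have [c ac cx] := atlas_cover x.
have near_f : {near x, (f \o chart_inv c) \o chart_fun c =1 f}.
  apply: filterS (open_nbhs_nbhs (conj (chart_dom_open c) cx)) => y cy.
  by rewrite /= chart_funK.
rewrite /continuous_at; apply: cvg_trans (near_eq_cvg near_f) _.
have -> : f x = ((f \o chart_inv c) \o chart_fun c) x by rewrite /= chart_funK.
apply: continuous_comp; first exact: chart_fun_continuous.
exact: Ck_continuous (smooth_Ck 0 sf ac) (chart_fun_range cx).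
Qed.

Lemma smooth_cst (a : R) : smooth (cst a : G -> R).
Proof. by apply: smooth_Ckl => c k ac; exact: Ck_cst. Qed.

Lemma smoothD f g : smooth f -> smooth g -> smooth (f \+ g).
Proof.
move=> sf sg; apply: smooth_Ckl => c k ac.
exact: Ck_add (chart_range_open c) (smooth_Ck k sf ac) (smooth_Ck k sg ac).
Qed.

Lemma smoothM f g : smooth f -> smooth g -> smooth (f \* g).
Proof.
move=> sf sg; apply: smooth_Ckl => c k ac.
exact: Ck_mul (chart_range_open c) (smooth_Ck k sf ac) (smooth_Ck k sg ac).
Qed.

Lemma smoothZ (a : R) f : smooth f -> smooth (fun x => a * f x).
Proof. by move=> sf; exact: (smoothM (smooth_cst a) sf). Qed.

Lemma smoothB f g : smooth f -> smooth g -> smooth (f \- g).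
Proof.
move=> sf sg; have := smoothD sf (smoothZ (-1) sg).
by congr smooth; apply/funext => x /=; rewrite mulN1r.
Qed.

Lemma smooth_sum (I : Type) (r : seq I) (F : I -> G -> R) :
  (forall i, smooth (F i)) -> smooth (fun x => \sum_(i <- r) F i x).
Proof.
move=> sF; elim: r => [|i r IH].
  have := smooth_cst 0; congr smooth; apply/funext => x; by rewrite big_nil.
have := smoothD (sF i) IH; congr smooth; apply/funext => x; by rewrite big_cons.
Qed.

Lemma Ck_expR k : Ck k setT (@expR R).
Proof.
have oT : open [set: R] by exact: openT.
elim: k => [|k IH]; first by split=> // x _; exact: continuous_expR.
split=> [x _|v]; first exact: continuous_expR.
have D x : is_derive x v (@expR R) (v * expR x).
  have := @derive_scale1 _ (@expR R) x v (@ex_derive _ _ _ _ _ _ _ (is_derive_expR x)).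
  by have [_ ->] := is_derive_expR x.
split=> [x _|]; first by have [] := D x.
by apply: Ck_eq (Ck_mul oT (Ck_cst setT k v) IH) => // x _; have [_ ->] := D x.
Qed.

Lemma smooth_expR f : smooth f -> smooth (fun x => expR (f x)).
Proof.
move=> sf; apply: smooth_Ckl => c k ac.
exact: Ck_comp1 (chart_range_open c) (fun _ _ => I) (Ck_expR k) (smooth_Ck k sf ac).
Qed.

(** Multiplication is jointly smooth, hence so is (p, q) |-> f (p q) read in
    any two charts, without restriction on the chart that contains p q. *)
Lemma smooth_mul_joint f c d k : smooth f -> atlas c -> atlas d ->
  Ck k [set p : 'rV[R]_n * 'rV[R]_n | chart_range c p.1 /\ chart_range d p.2]
    (fun p => f (chart_inv c p.1 * chart_inv d p.2)%g).
Proof.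
move=> sf ac ad; set A := [set p | _].
pose m (p : 'rV[R]_n * 'rV[R]_n) := (chart_inv c p.1 * chart_inv d p.2)%g.
have oA : open A.
  apply: (@openI _ (fst @^-1` chart_range c) (snd @^-1` chart_range d)).
    by apply: open_comp (chart_range_open c) => p _; exact: cvg_fst.
  by apply: open_comp (chart_range_open d) => p _; exact: cvg_snd.
have cm p : A p -> {for p, continuous m}.
  move=> [cp dp]; apply: (@continuous_comp _ _ _
    (fun p : 'rV[R]_n * 'rV[R]_n => (chart_inv c p.1, chart_inv d p.2))
    (fun q : G * G => (q.1 * q.2)%g)); last exact: lie_mulg_continuous.
  apply: cvg_pair.
    apply: (@continuous_comp _ _ _ fst (chart_inv c)); first exact: cvg_fst.
    exact: chart_inv_continuous.
  apply: (@continuous_comp _ _ _ snd (chart_inv d)); first exact: cvg_snd.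
  exact: chart_inv_continuous.
move: k; apply/smooth_onP => vs p Ap.
have [e ae ep] := atlas_cover (m p).
pose Ae := [set p | A p /\ chart_dom e (m p)].
have oAe : open Ae by apply: open_preimage_on => //; exact: chart_dom_open.
suff : smooth_on Ae (f \o m) by apply; split.
apply/smooth_onP => k.
have Cfe := smooth_Ck k sf ae.
have Cm : Ck k Ae (fun p => chart_fun e (m p)).
  have /smooth_onP/(_ k) := lie_mulg_smooth _ _ _ ac ad ae.
  by apply: Ck_subset => q [[qc qd] qe]; split.
apply: Ck_eq (Ck_comp oAe (chart_range_open e) _ Cfe Cm) => //.
  by move=> q [_ qe] /=; rewrite chart_funK.
by move=> q [_ qe]; exact: chart_fun_range.
Qed.

End SmoothFunctions.

(** Partial derivatives in the second variable are derivatives along (0, v). *)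
Lemma derive_sliceE (R : realType) (V1 V2 W : normedModType R) (F : V1 * V2 -> W)
    (p : V1) (q v : V2) :
  (fun h : R => h^-1 *: (((fun q => F (p, q)) \o shift q) (h *: v) - F (p, q))) =
  (fun h => h^-1 *: ((F \o shift (p, q)) (h *: (0, v)) - F (p, q))).
Proof.
apply/funext => h; congr (_ *: (F _ - _)); apply/esym.
transitivity (h *: (0 : V1) + p, h *: v + q); first by [].
by rewrite scaler0 add0r.
Qed.

Lemma Ck_slice (R : realType) (V1 V2 W : normedModType R) k (A : set (V1 * V2))
    (F : V1 * V2 -> W) (p : V1) :
  Ck k A F -> Ck k [set q | A (p, q)] (fun q => F (p, q)).
Proof.
have pc q : {for q, continuous (fun q : V2 => (p, q))}.
  by apply: cvg_pair; [exact: cvg_cst|exact: cvg_id].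
elim: k F => [|k IH] F [cF dF].
  by split=> // q Aq; apply: (continuous_comp (pc q)); exact: cF.
split=> [q Aq|v]; first by apply: (continuous_comp (pc q)); exact: cF.
have [dv Cv] := dF (0, v); split=> [q Aq|].
  by rewrite /derivable derive_sliceE; exact: dv.
have -> : 'D_v (fun q => F (p, q)) = (fun q => 'D_(0, v) F (p, q)).
  by apply/funext => q; rewrite /derive derive_sliceE.
exact: (IH _ Cv).
Qed.

Lemma smooth_translate (R : realType) (n : nat) (G : lieGroupType R n)
  (f : G -> R) (a : G) : smooth f -> smooth (fun x => f (a * x)%g).
Proof.
move=> sf; apply: smooth_Ckl => d k ad; have [c ac ca] := atlas_cover a.
have Cs := Ck_slice (chart_fun c a) (smooth_mul_joint k sf ac ad).
have {}Cs : Ck k (chart_range d)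
    (fun q => f (chart_inv c (chart_fun c a) * chart_inv d q)%g).
  by apply: Ck_subset Cs => q dq; split=> //; exact: chart_fun_range.
apply: (@Ck_eq R 'rV[R]_n R (chart_range d) k _ _ _ _ Cs).
  exact: chart_range_open.
by move=> q dq; rewrite /= chart_funK.
Qed.

(** * Vector fields as derivations *)

(* Keeping smoothness folded prevents automation from entering its definition. *)
Opaque smooth.

Section VectorFields.
Context (R : realType) (n : nat) (G : lieGroupType R n).
Implicit Types (f g : G -> R) (X : operator G).

Lemma field_smooth X f : vector_field X -> smooth f -> smooth (X f).
Proof. by move=> vX sf; exact: (vX.2 f sf). Qed.

Lemma smooth_chart_derivable f c x v : smooth f -> atlas c ->
  chart_dom c x -> derivable (f \o chart_inv c) (chart_fun c x) v.
Proof.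
move=> sf ac cx.
exact: Ck_derivable (smooth_Ck 1 sf ac) (chart_fun_range cx).
Qed.

(** Tangent vectors are derivations that only depend on germs. *)
Lemma field_local X f g x : vector_field X -> smooth f -> smooth g ->
  {near x, f =1 g} -> X f x = X g x.
Proof.
move=> [tX _] sf sg fg; have [c [v [ac cx XE]]] := tX x.
rewrite (XE _ sf) (XE _ sg); apply: near_eq_derive.
by apply: filterS (chart_inv_nbhs cx fg) => y [].
Qed.

Lemma fieldD X f g x : vector_field X -> smooth f -> smooth g ->
  X (f \+ g) x = X f x + X g x.
Proof.
move=> [tX _] sf sg; have [c [v [ac cx XE]]] := tX x.
rewrite (XE _ sf) (XE _ sg) (XE _ (smoothD sf sg)).
have <- := deriveD (smooth_chart_derivable (v := v) sf ac cx)
  (smooth_chart_derivable (v := v) sg ac cx).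
by congr derive.
Qed.

Lemma fieldM X f g x : vector_field X -> smooth f -> smooth g ->
  X (f \* g) x = f x * X g x + g x * X f x.
Proof.
move=> [tX _] sf sg; have [c [v [ac cx XE]]] := tX x.
rewrite (XE _ sf) (XE _ sg) (XE _ (smoothM sf sg)).
have := deriveM (smooth_chart_derivable (v := v) sf ac cx)
  (smooth_chart_derivable (v := v) sg ac cx).
rewrite [(f \o _) _]/= [(g \o _) _]/= (chart_funK cx) => <-.
by congr derive.
Qed.

Lemma field_cst X (a : R) x : vector_field X -> X (cst a) x = 0.
Proof.
move=> [tX _]; have [c [v [ac cx XE]]] := tX x.
by rewrite (XE _ (smooth_cst a)); exact: derive_cst.
Qed.

Lemma fieldZ X (a : R) f x : vector_field X -> smooth f ->
  X (fun x => a * f x) x = a * X f x.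
Proof.
move=> vX sf; rewrite (fieldM x vX (smooth_cst a) sf) (field_cst a x vX).
by rewrite mulr0 addr0.
Qed.

Lemma fieldB X f g x : vector_field X -> smooth f -> smooth g ->
  X (f \- g) x = X f x - X g x.
Proof.
move=> vX sf sg; have -> : f \- g = f \+ (fun x => -1 * g x).
  by apply/funext => y /=; rewrite mulN1r.
by rewrite (fieldD x vX sf (smoothZ (-1) sg)) (fieldZ (-1) x vX sg) mulN1r.
Qed.

Lemma field_expR X f x : vector_field X -> smooth f ->
  X (fun x => expR (f x)) x = expR (f x) * X f x.
Proof.
move=> [tX _] sf; have [c [v [ac cx XE]]] := tX x.
rewrite (XE _ sf) (XE _ (smooth_expR sf)).
have dE := is_derive_expR ((f \o chart_inv c) (chart_fun c x)).
have [_] := is_derive_comp1 (@ex_derive _ _ _ _ _ _ _ dE)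
  (smooth_chart_derivable (v := v) sf ac cx).
rewrite -[X in X = _ -> _]/('D_v (fun y => expR (f (chart_inv c y))) _) => ->.
by have [_ ->] := dE; rewrite mulrC /= (chart_funK cx).
Qed.

Lemma field_eq0 X f x : vector_field X -> smooth f ->
  (\forall y \near x, f y = 0) -> X f x = 0.
Proof.
move=> vX sf f0; rewrite (field_local vX sf (smooth_cst 0) f0).
exact: field_cst.
Qed.

(** A field that is invariant under left translations differentiates along
    right translations by a curve issued from 1. *)
Lemma invariant_field_at1 X f x : left_invariant_field X -> smooth f ->
  X f x = X (fun y => f (x * y)%g) 1%g.
Proof. by move=> [_ inv] sf; rewrite (inv _ _ sf) mulg1. Qed.

Lemma field_translate X f a x : left_invariant_field X -> smooth f ->
  X (fun x => f (a * x)%g) x = X f (a * x)%g.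
Proof. by move=> [_ inv] sf; rewrite (inv _ _ sf). Qed.

End VectorFields.

(** * Compactness and separated nets *)

Lemma rV_ball_compact (R : realType) (n : nat) (a : 'rV[R]_n) (r : R) :
  compact [set y : 'rV[R]_n | `|y - a| <= r].
Proof.
apply: bounded_closed_compact.
  exists (r + `|a|); split; first exact: num_real.
  move=> M rM y By; have := ler_normD (y - a) a; rewrite subrK => /le_trans; apply.
  by apply: le_trans (ltW rM); rewrite lerD2r.
have -> : [set y : 'rV[R]_n | `|y - a| <= r] =
    (fun y : 'rV[R]_n => `|y - a|) @^-1` [set t | t <= r] by [].
apply: closed_comp; last exact: closed_le.
move=> y _; apply: (@continuous_comp _ _ _ (fun y : 'rV[R]_n => y - a)
    (fun z : 'rV[R]_n => `|z|)); last exact: norm_continuous.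
exact: (continuousB (f := id) (g := cst a) (fun _ => id) (@cst_continuous _ _ a y)).
Qed.

Section Compactness.
Context (R : realType) (n : nat) (G : lieGroupType R n).
Implicit Types (K A B : set G) (x y z : G).

(** The product set A B. *)
Definition mulset A B : set G := (fun p : G * G => (p.1 * p.2)%g) @` (A `*` B).

Lemma mulset_compact A B : compact A -> compact B -> compact (mulset A B).
Proof.
move=> cA cB; apply: continuous_compact; last exact: compact_setX.
by apply: continuous_subspaceT; exact: lie_mulg_continuous.
Qed.

Lemma lie_compact_closed K : compact K -> closed K.
Proof. by apply: compact_closed; exact: manifold_hausdorff. Qed.

Lemma mulgl_continuous a : continuous (fun x : G => (a * x)%g).
Proof.
move=> x; apply: (@continuous_comp _ _ _ (fun x : G => (a, x))
  (fun p : G * G => (p.1 * p.2)%g)); last exact: lie_mulg_continuous.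
by apply: cvg_pair; [exact: cvg_cst|exact: cvg_id].
Qed.

Lemma mulgr_continuous a : continuous (fun x : G => (x * a)%g).
Proof.
move=> x; apply: (@continuous_comp _ _ _ (fun x : G => (x, a))
  (fun p : G * G => (p.1 * p.2)%g)); last exact: lie_mulg_continuous.
by apply: cvg_pair; [exact: cvg_id|exact: cvg_cst].
Qed.

(** Bump functions on the group: one of R^n is read in a chart c at x0 and
    extended by 0. Smoothness in another chart d holds on two open pieces
    that cover it: the domain of c, and the complement of the compact P. *)
Lemma bump_manifold x0 : exists (phi : G -> R) (P : set G),
  [/\ smooth phi, forall x, 0 <= phi x <= 1, \forall x \near x0, phi x = 1,
      compact P & forall x, ~ P x -> phi x = 0].
Proof.
have [c ac cx0] := atlas_cover x0; set a := chart_fun c x0.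
have := open_nbhs_nbhs (conj (chart_range_open c) (chart_fun_range cx0)).
move=> /nbhs_ballP[e /= e0 ae].
have r0 : 0 < e / 3 by rewrite divr_gt0.
set r := e / 3 in r0.
have [phi0 [Cphi phi01 phi1 phi2]] := bump_rV a r0.
pose B : set 'rV[R]_n := [set y | `|y - a| <= 2 * r].
have BR : B `<=` chart_range c.
  move=> y By; apply: ae; rewrite -ball_normE /ball_ /= distrC.
  by rewrite (le_lt_trans By)// /r; lra.
have cB : compact B by exact: rV_ball_compact.
pose P := chart_inv c @` B.
have cP : compact P.
  apply: continuous_compact => //; apply: continuous_in_subspaceT => y.
  by rewrite inE => /BR; exact: chart_inv_continuous.
pose phi x := if `[< chart_dom c x >] then phi0 (chart_fun c x) else 0.
have phiP x : ~ P x -> phi x = 0.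
  rewrite /phi; case: asboolP => // cx nPx; apply: phi2.
  rewrite leNgt; apply/negP => lt2; apply: nPx.
  by exists (chart_fun c x); [exact: ltW|rewrite chart_funK].
exists phi, P; split => //.
- move=> d ad vs y dy.
  have [cy|ncy] := pselect (chart_dom c (chart_inv d y)).
    pose A := chart_fun d @` (chart_dom d `&` chart_dom c).
    have AE : A = [set y | chart_range d y /\ chart_dom c (chart_inv d y)].
      apply/seteqP; split=> [_ [x [dx cx] <-]|w [dw cw]].
        by split; [exact: chart_fun_range|rewrite chart_funK].
      exists (chart_inv d w); last exact: chart_invK.
      by split => //; exact: chart_inv_dom.
    have oA : open A by rewrite AE; apply: open_chart_inv; exact: chart_dom_open.
    suff : smooth_on A (phi \o chart_inv d) by apply; rewrite AE.
    apply/smooth_onP => k.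
    have /smooth_onP/(_ k) Ccd := atlas_compat _ _ ad ac.
    apply: Ck_eq (Ck_comp oA openT (fun _ _ => I) (Cphi k) Ccd) => //.
    by move=> w; rewrite AE => -[_ cw]; rewrite /= /phi asboolT.
  pose A := [set y | chart_range d y /\ (~` P) (chart_inv d y)].
  have oA : open A.
    by apply: open_chart_inv; rewrite openC; exact: lie_compact_closed.
  suff : smooth_on A (phi \o chart_inv d).
    apply; split => // -[w Bw wE]; apply: ncy; rewrite -wE.
    exact: chart_inv_dom (BR _ Bw).
  apply/smooth_onP => k; apply: Ck_eq (Ck_cst A k (0 : R)) => //.
  by move=> w [_ /phiP].
- by move=> x; rewrite /phi; case: ifP => _; rewrite ?phi01// lexx ler01.
- have near_a : \forall y \near a, `|y - a| <= r.
    apply/nbhs_ballP; exists r => // y; rewrite -ball_normE /ball_/= distrC.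
    exact: ltW.
  have := chart_fun_continuous cx0 near_a; rewrite /= => near_x0.
  near=> x; rewrite /phi asboolT.
    by apply: phi1; near: x.
  by near: x; exact: open_nbhs_nbhs (conj (chart_dom_open c) cx0).
Unshelve. all: by end_near. Qed.

Lemma compact_continuous_bounded K (f : G -> R) : compact K -> continuous f ->
  exists2 C : R, 0 <= C & forall x, K x -> `|f x| <= C.
Proof.
move=> cK cf.
have cfK : compact (f @` K).
  by apply: continuous_compact => //; exact: continuous_subspaceT.
have [M [_ HM]] := compact_bounded cfK.
exists (Num.max 0 (M + 1)) => [|x Kx]; first by rewrite le_max lexx.
apply: HM; last by exists x.
by rewrite lt_max ltrDl ltr01 orbT.
Qed.

(** Points of a compact set that are pairwise separated by a neighbourhood D
    of the diagonal are boundedly many: pigeonhole in a finite cover by sets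
    whose points are D-close to each other. *)
Lemma separated_size_bound K (D : G -> G -> Prop) : compact K ->
  (forall q, K q -> exists2 O, nbhs q O & forall p p', O p -> O p' -> D p p') ->
  exists m, forall S : seq G, uniq S -> (forall z, z \in S -> K z) ->
    (forall z z', z \in S -> z' \in S -> D z z' -> z = z') -> (size S <= m)%N.
Proof.
move=> cK small.
have /choice[N NP] : forall q, exists B : set G, K q ->
    [/\ open B, B q & forall p p', B p -> B p' -> D p p'].
  move=> q.
  have [Kq|nKq] := pselect (K q); last by exists set0 => /nKq.
  have [B qB DB] := small _ Kq; exists B° => _; split.
  - exact: open_interior.
  - exact: qB.
  - by move=> p p' /interior_subset Op /interior_subset Op'; exact: DB.
have := cK; rewrite compact_cover => /(_ G K N) [].
- by move=> q /NP[].
- by move=> q Kq; exists q => //; have [] := NP _ Kq.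
move=> F FK KF; exists (size (finmap.enum_fset F)) => S uS SK sepS.
have /choice[i Pi] : forall z, exists q, K z -> q \in finmap.enum_fset F /\ N q z.
  move=> z.
  have [Kz|nKz] := pselect (K z); last by exists z => /nKz.
  by have [q Fq Nqz] := KF _ Kz; exists q.
rewrite -(size_map i); apply: uniq_leq_size.
  rewrite map_inj_in_uniq// => z z' zS z'S izz'; apply: sepS => //.
  have [Fi Oz] := Pi _ (SK _ zS); have [_ Oz'] := Pi _ (SK _ z'S).
  have [_ _] := NP _ (set_mem (FK _ Fi)); apply => //; by rewrite izz'.
by move=> _ /mapP[z zS ->]; have [] := Pi _ (SK _ zS).
Qed.

(** A separated family of points of K of maximal size: K is covered by the
    neighbourhoods of these points defined by W. *)
Lemma separated_net K (W : set G) : compact K -> nbhs 1%g W ->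
  exists S : seq G, [/\ uniq S, forall z, z \in S -> K z,
    forall z z', z \in S -> z' \in S -> W (z^-1 * z')%g -> z = z'
    & forall x, K x -> exists2 z, z \in S & W (z^-1 * x)%g \/ W (x^-1 * z)%g].
Proof.
move=> cK W1.
have small q : K q -> exists2 O, nbhs q O &
    forall p p', O p -> O p' -> W (p^-1 * p')%g.
  move=> _.
  have c : {for (q, q), continuous (fun p : G * G => (p.1^-1 * p.2)%g)}.
    apply: (@continuous_comp _ _ _ (fun p : G * G => (p.1^-1, p.2)%g)
      (fun p : G * G => (p.1 * p.2)%g)); last exact: lie_mulg_continuous.
    apply: cvg_pair; last exact: cvg_snd.
    apply: (@continuous_comp _ _ _ fst (fun x : G => (x^-1)%g)); first exact: cvg_fst.
    exact: lie_invg_continuous.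
  have [] := c W; first by rewrite /= mulVg.
  move=> [B1 B2] /= [qB1 qB2] sub; exists (B1 `&` B2); first exact: filterI.
  by move=> p p' [B1p _] [_ B2p']; exact: (sub (p, p')).
have [m Hm] := separated_size_bound cK small.
pose good j := `[< exists S : seq G, [/\ uniq S, forall z, z \in S -> K z,
    forall z z', z \in S -> z' \in S -> W (z^-1 * z')%g -> z = z' & size S = j] >].
have good0 : exists j, good j by exists 0%N; apply/asboolP; exists [::].
have goodm j : good j -> (j <= m)%N.
  by move=> /asboolP[S [uS SK sepS <-]]; exact: Hm.
have [j /asboolP[S [uS SK sepS Sj]] jmax] := ex_maxnP good0 goodm.
exists S; split=> // x Kx; apply: contrapT => nx.
have nxS z : z \in S -> ~ W (z^-1 * x)%g /\ ~ W (x^-1 * z)%g.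
  by move=> zS; split=> Wz; apply: nx; exists z; auto.
have xS : x \notin S.
  by apply/negP => /nxS[+ _]; rewrite mulVg; apply; exact: nbhs_singleton.
suff : good j.+1 by move=> /jmax; rewrite ltnn.
apply/asboolP; exists (x :: S); split=> /=.
- by rewrite xS.
- by move=> z; rewrite inE => /predU1P[->//|/SK].
- move=> z z'; rewrite !inE => /predU1P[->|zS] /predU1P[->|z'S]//.
  + by move=> Wx; have [] := nxS _ z'S.
  + by move=> Wx; have [] := nxS _ zS.
  + exact: sepS.
- by rewrite Sj.
Qed.

End Compactness.

(** * Products of translates of a bump *)

(** The number of points z of S such that x belongs to the translate z P. *)
Definition hits (R : realType) (n : nat) (G : lieGroupType R n) (P : set G)
    (S : seq G) (x : G) : nat :=
  count (fun z => `[< P (z^-1 * x)%g >]) S.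

Section TranslatedProducts.
Context (R : realType) (n : nat) (G : lieGroupType R n).
Context (k : nat) (X : 'I_k -> operator G).
Hypothesis X_inv : forall j, left_invariant_field (X j).
Context (phi : G -> R) (P : set G) (C : R).
Hypotheses (phi_smooth : smooth phi) (phi01 : forall x, 0 <= phi x <= 1).
Hypotheses (P_closed : closed P) (phi_off : forall x, ~ P x -> phi x = 0).
Hypothesis (X_phi : forall j x, `|X j phi x| <= C).
Hypothesis XX_phi : forall j l x, `|X j (X l phi) x| <= C.

Let vX j : vector_field (X j) := (X_inv j).1.

Let q z : G -> R := fun x => 1 - phi (z^-1 * x)%g.

(** The product over z in S of 1 - phi (z^-1 x). *)
Definition translate_prod (S : seq G) : G -> R := fun x => \prod_(z <- S) q z x.

(* The contribution of z to hits. *)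
Let hit z x : nat := `[< P (z^-1 * x)%g >].

Let sq z : smooth (q z).
Proof. exact: smoothB (smooth_cst 1) (smooth_translate _ phi_smooth). Qed.

Let Xq j z x : X j (q z) x = - X j phi (z^-1 * x)%g.
Proof.
rewrite (fieldB x (vX j) (smooth_cst 1) (smooth_translate z^-1%g phi_smooth)).
by rewrite (field_cst 1 x (vX j)) sub0r (field_translate _ _ (X_inv j) phi_smooth).
Qed.

Let sXphi j : smooth (X j phi).
Proof. exact: field_smooth (vX j) phi_smooth. Qed.

Let XXq j l z x : X j (X l (q z)) x = - X j (X l phi) (z^-1 * x)%g.
Proof.
have -> : X l (q z) = (fun x => -1 * X l phi (z^-1 * x)%g).
  by apply/funext => y; rewrite Xq mulN1r.
rewrite (fieldZ (-1) x (vX j) (smooth_translate z^-1%g (sXphi l))) mulN1r.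
by rewrite (field_translate _ _ (X_inv j) (sXphi l)).
Qed.

Let off_near (g : G -> R) x : (forall x, ~ P x -> g x = 0) -> ~ P x ->
  \forall y \near x, g y = 0.
Proof.
move=> g0 nPx; have oP : open (~` P) by rewrite openC.
by apply: filterS (open_nbhs_nbhs (conj oP nPx)) => y; exact: g0.
Qed.

Let Xphi_off j x : ~ P x -> X j phi x = 0.
Proof. by move=> nPx; apply: field_eq0 (vX j) phi_smooth (off_near phi_off nPx). Qed.

Let XXphi_off j l x : ~ P x -> X j (X l phi) x = 0.
Proof.
by move=> nPx; apply: field_eq0 (vX j) (sXphi l) (off_near (@Xphi_off l) nPx).
Qed.

Let Xq_le j z x : `|X j (q z) x| <= C * (hit z x)%:R.
Proof.
rewrite Xq normrN /hit; case: asboolP => [_|nP]; first by rewrite mulr1.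
by rewrite Xphi_off// normr0 mulr0.
Qed.

Let XXq_le j l z x : `|X j (X l (q z)) x| <= C * (hit z x)%:R.
Proof.
rewrite XXq normrN /hit; case: asboolP => [_|nP]; first by rewrite mulr1.
by rewrite XXphi_off// normr0 mulr0.
Qed.

Let q01 z x : 0 <= q z x <= 1.
Proof. by rewrite /q; have := phi01 (z^-1 * x)%g; lra. Qed.

Lemma translate_prod01 S x : 0 <= translate_prod S x <= 1.
Proof.
rewrite /translate_prod prodr_ge0/= => [|z _]; last by have /andP[] := q01 z x.
by apply: prodr_ile1 => z _; exact: q01.
Qed.

Let tp_cons z S : translate_prod (z :: S) = q z \* translate_prod S.
Proof. by apply/funext => x; rewrite /translate_prod big_cons. Qed.

Lemma smooth_translate_prod S : smooth (translate_prod S).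
Proof.
elim: S => [|z S IH]; last by rewrite tp_cons; exact: smoothM (sq z) IH.
have -> : translate_prod [::] = cst 1; last exact: smooth_cst.
by apply/funext => x; rewrite /translate_prod big_nil.
Qed.

Let tp0 : translate_prod [::] = cst 1.
Proof. by apply/funext => x; rewrite /translate_prod big_nil. Qed.

Let Xtp_cons j z S : X j (translate_prod (z :: S)) =
  q z \* X j (translate_prod S) \+ translate_prod S \* X j (q z).
Proof.
apply/funext => x; rewrite tp_cons.
exact: fieldM (vX j) (sq z) (smooth_translate_prod S).
Qed.

(** Only the factors hit by x contribute to the derivative of the product at
    x, so that the bound does not involve the size of S. *)
Lemma field_translate_prod_le j S x :
  `|X j (translate_prod S) x| <= C * (hits P S x)%:R.
Proof.
elim: S => [|z S IH]; first by rewrite tp0 (field_cst 1 x (vX j)) normr0 mulr0.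
rewrite Xtp_cons /= (le_trans (ler_normD _ _))// natrD mulrDr addrC !normrM.
have /andP[q0 q1] := q01 z x; have /andP[t0 t1] := translate_prod01 S x.
apply: lerD.
  by rewrite (le_trans _ (Xq_le j z x))// ger0_norm// ler_piMl.
by rewrite (le_trans _ IH)// ger0_norm// ler_piMl.
Qed.

Lemma field2_translate_prod_le j l S x :
  `|X j (X l (translate_prod S)) x| <=
    C * (hits P S x)%:R + C ^+ 2 * (hits P S x)%:R ^+ 2.
Proof.
elim: S => [|z S IH].
  rewrite tp0 (_ : X l (cst 1) = cst 0).
    by rewrite (field_cst 0 x (vX j)) normr0 mulr0 expr0n mulr0 addr0.
  by apply/funext => y; exact: field_cst (vX l).
have sX := field_smooth (vX l) (smooth_translate_prod S).
have sXq := field_smooth (vX l) (sq z).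
rewrite Xtp_cons (fieldD x (vX j) (smoothM (sq z) sX)
  (smoothM (smooth_translate_prod S) sXq)).
rewrite (fieldM x (vX j) (sq z) sX).
rewrite (fieldM x (vX j) (smooth_translate_prod S) sXq).
have /andP[q0 q1] := q01 z x; have /andP[t0 t1] := translate_prod01 S x.
have h1 : `|q z x * X j (X l (translate_prod S)) x| <=
    C * (hits P S x)%:R + C ^+ 2 * (hits P S x)%:R ^+ 2.
  by rewrite normrM (le_trans _ IH)// ger0_norm// ler_piMl.
have h2 : `|X l (translate_prod S) x * X j (q z) x| <=
    C ^+ 2 * (hits P S x)%:R * (hit z x)%:R.
  rewrite normrM (_ : _ * _ * _ = C * (hits P S x)%:R * (C * (hit z x)%:R)); last by ring.
  by rewrite ler_pM ?field_translate_prod_le ?Xq_le.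
have h3 : `|translate_prod S x * X j (X l (q z)) x| <= C * (hit z x)%:R.
  by rewrite normrM (le_trans _ (XXq_le j l z x))// ger0_norm// ler_piMl.
have h4 : `|X l (q z) x * X j (translate_prod S) x| <=
    C ^+ 2 * (hits P S x)%:R * (hit z x)%:R.
  rewrite normrM (_ : _ * _ * _ = C * (hit z x)%:R * (C * (hits P S x)%:R)); last by ring.
  by rewrite ler_pM ?field_translate_prod_le ?Xq_le.
rewrite (le_trans (ler_normD _ _))//.
rewrite (le_trans (lerD (ler_normD _ _) (ler_normD _ _)))//.
rewrite (le_trans (lerD (lerD h1 h2) (lerD h3 h4)))// /= natrD -/(hit z x).
have hit0 : 0 <= C ^+ 2 * (hit z x)%:R ^+ 2 by rewrite mulr_ge0 ?sqr_ge0.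
rewrite -subr_ge0; apply: le_trans hit0 _; rewrite le_eqVlt; apply/orP; left.
by apply/eqP; rewrite /hits; ring.
Qed.

End TranslatedProducts.

(** * Plateau functions and exhaustion by compact sets *)

Section Cutoffs.
Context (R : realType) (n : nat) (G : lieGroupType R n).
Context (k : nat) (X : 'I_k -> operator G).
Hypothesis X_inv : forall j, left_invariant_field (X j).

Let vX j : vector_field (X j) := (X_inv j).1.

(** Plateau functions with derivatives bounded independently of the compact
    set K: eta = 1 - prod_z (1 - phi (z^-1 x)) for a fixed bump phi, z running
    over a separated net of K. A point x belongs to a bounded number of the
    translates z P, and left-invariant derivatives of translates of phi are
    translates of derivatives of phi. *)
Lemma uniform_plateau : exists (C : R) (P : set G),
  [/\ 0 <= C, compact P, nbhs 1%g P & forall K, compact K ->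
    exists eta : G -> R, [/\ smooth eta, forall x, 0 <= eta x <= 1,
      forall x, K x -> eta x = 1, forall x, eta x != 0 -> mulset K P x
      & (forall j x, `|X j eta x| <= C) /\
        (forall j l x, `|X j (X l eta) x| <= C)]].
Proof.
have [phi [P [sphi phi01 phi1 cP phi0]]] := @bump_manifold R n G 1%g.
have P1 : nbhs 1%g P.
  apply: filterS phi1 => x x1; apply: contrapT => /phi0.
  by rewrite x1 => /eqP; rewrite oner_eq0.
have clP := lie_compact_closed cP.
have bounded_on_P (g : G -> R) : smooth g -> exists2 c : R, 0 <= c &
    forall x, P x -> `|g x| <= c.
  move=> sg; apply: compact_continuous_bounded cP _; exact: smooth_continuous.
have sX j := field_smooth (vX j) sphi.
have sXX j l := field_smooth (vX j) (sX l).
have /choice[c1 c1P] j : exists c : R, 0 <= c /\ forall x, P x -> `|X j phi x| <= c.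
  by have [c c0 cP'] := bounded_on_P _ (sX j); exists c.
have /choice[c2 c2P] jl : exists c : R, 0 <= c /\
    forall x, P x -> `|X jl.1 (X jl.2 phi) x| <= c.
  by have [c c0 cP'] := bounded_on_P _ (sXX jl.1 jl.2); exists c.
pose C := \sum_j c1 j + \sum_jl c2 jl.
have s1 : 0 <= \sum_j c1 j by apply: sumr_ge0 => j _; have [] := c1P j.
have s2 : 0 <= \sum_jl c2 jl by apply: sumr_ge0 => j _; have [] := c2P j.
have C0 : 0 <= C by rewrite addr_ge0.
have oP : open (~` P) by rewrite openC.
have off (g : G -> R) x : (forall x, ~ P x -> g x = 0) -> ~ P x ->
    \forall y \near x, g y = 0.
  by move=> g0 nPx; apply: filterS (open_nbhs_nbhs (conj oP nPx)) => y; exact: g0.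
have X0 j x : ~ P x -> X j phi x = 0.
  by move=> nPx; exact: field_eq0 (vX j) sphi (off _ _ phi0 nPx).
have XX0 j l x : ~ P x -> X j (X l phi) x = 0.
  by move=> nPx; exact: field_eq0 (vX j) (sX l) (off _ _ (X0 l) nPx).
have Xphi j x : `|X j phi x| <= C.
  have [Px|/X0->] := pselect (P x); last by rewrite normr0.
  rewrite (le_trans ((c1P j).2 _ Px))// /C (bigD1 j)//= -addrA lerDl.
  by rewrite addr_ge0// sumr_ge0// => i _; have [] := c1P i.
have XXphi j l x : `|X j (X l phi) x| <= C.
  have [Px|/XX0->] := pselect (P x); last by rewrite normr0.
  rewrite (le_trans ((c2P (j, l)).2 _ Px))// /C (bigD1 (j, l))//= addrCA lerDl.
  by rewrite addr_ge0// sumr_ge0// => i _; have [] := c2P i.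
(* A symmetric neighbourhood of 1 on which phi = 1 *)
pose W : set G := [set x | phi x = 1 /\ phi (x^-1)%g = 1].
have W1 : nbhs 1%g W.
  apply: filterI => //.
  have : nbhs (1^-1)%g [set x | phi x = 1] by rewrite invg1.
  by move/(@lie_invg_continuous R n G 1%g).
have small q : P q -> exists2 B, nbhs q B &
    forall p p', B p -> B p' -> W (p * p'^-1)%g.
  move=> _.
  have c : {for (q, q), continuous (fun p : G * G => (p.1 * p.2^-1)%g)}.
    apply: (@continuous_comp _ _ _ (fun p : G * G => (p.1, p.2^-1)%g)
      (fun p : G * G => (p.1 * p.2)%g)); last exact: lie_mulg_continuous.
    apply: cvg_pair; first exact: cvg_fst.
    apply: (@continuous_comp _ _ _ snd (fun x : G => (x^-1)%g)); first exact: cvg_snd.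
    exact: lie_invg_continuous.
  have [] := c W; first by rewrite /= mulgV.
  move=> [B1 B2] /= [qB1 qB2] sub; exists (B1 `&` B2); first exact: filterI.
  by move=> p p' [B1p _] [_ B2p']; exact: (sub (p, p')).
(* m bounds the number of net points z with x in z P, i.e. z^-1 x in P *)
have [m Hm] := separated_size_bound cP small.
exists (C * m%:R + C ^+ 2 * m%:R ^+ 2), P; split=> //.
  by rewrite addr_ge0 ?mulr_ge0 ?sqr_ge0.
move=> K cK; have [S [uS SK sepS covS]] := separated_net cK W1.
pose T := translate_prod phi S.
have sT : smooth T := smooth_translate_prod sphi S.
have hitsm x : (hits P S x <= m)%N.
  pose S' := [seq (z^-1 * x)%g | z <- S & `[< P (z^-1 * x)%g >]].
  have -> : hits P S x = size S' by rewrite size_map size_filter.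
  apply: Hm.
  - rewrite map_inj_uniq ?filter_uniq// => z z' /mulIg; exact: invg_inj.
  - by move=> _ /mapP[z + ->]; rewrite mem_filter => /andP[/asboolP].
  - move=> _ _ /mapP[z + ->] /mapP[z' + ->]; rewrite !mem_filter.
    move=> /andP[_ zS] /andP[_ z'S].
    by rewrite invgM invgK mulgA mulgK => /sepS ->.
have hitsR x : (hits P S x)%:R <= m%:R :> R by rewrite ler_nat.
have t01 := translate_prod01 phi01 S.
have XT j : X j (fun x => 1 - T x) = (fun x => -1 * X j T x).
  apply/funext => x.
  by rewrite (fieldB x (vX j) (smooth_cst 1) sT) (field_cst 1 x (vX j)) sub0r mulN1r.
exists (fun x => 1 - T x); split.
- exact: smoothB (smooth_cst 1) sT.
- by move=> x; have := t01 x; rewrite -/T; lra.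
- move=> x Kx; have [z zS Wz] := covS x Kx.
  rewrite /T /translate_prod (big_rem z)//= (_ : phi _ = 1) ?subrr ?mul0r ?subr0//.
  by case: Wz => -[]//; rewrite invgM invgK.
- move=> x; apply: contra_neqP => nKPx.
  rewrite /T /translate_prod big_seq big1 ?subrr// => z zS.
  rewrite phi0 ?subr0// => Pz; apply: nKPx.
  by exists (z, (z^-1 * x)%g) => /=; [split=> //; exact: SK|rewrite mulVKg].
- split=> [j x|j l x].
    rewrite XT mulN1r normrN.
    rewrite (le_trans (field_translate_prod_le X_inv sphi phi01 clP phi0 Xphi j S x))//.
    apply: ler_wpDr; first by rewrite mulr_ge0 ?sqr_ge0.
    exact: ler_wpM2l.
  rewrite XT (fieldZ (-1) x (vX j) (field_smooth (vX l) sT)) mulN1r normrN.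
  rewrite (le_trans (field2_translate_prod_le X_inv sphi phi01 clP phi0 Xphi XXphi j l S x))//.
  by apply: lerD; apply: ler_wpM2l => //; rewrite ?sqr_ge0// lerXn2r ?nnegrE.
Qed.

(** The powers of P, an exhaustion of the group by compact sets when P is a
    compact neighbourhood of 1 and the group is connected. *)
Fixpoint power_set (P : set G) i : set G :=
  if i is i'.+1 then mulset (power_set P i') P else [set 1%g].

Lemma power_set_compact P i : compact P -> compact (power_set P i).
Proof.
move=> cP; elim: i => [|i IH] /=; first exact: compact_set1.
exact: mulset_compact.
Qed.

Lemma power_setS P i : P 1%g -> power_set P i `<=` power_set P i.+1.
Proof. by move=> P1 x Px; exists (x, 1%g); rewrite //= mulg1. Qed.

Lemma power_set_le P i j : P 1%g -> (i <= j)%N -> power_set P i `<=` power_set P j.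
Proof.
move=> P1 /subnK <-; elim: (j - i)%N => [//|d IH].
by apply: subset_trans IH _; exact: power_setS.
Qed.

(** The union of the powers of P is open and closed. *)
Lemma power_set_exhausts P : connected [set: G] -> nbhs 1%g P ->
  forall x, exists i, power_set P i x.
Proof.
move=> cG P1 x; pose U : set G := \bigcup_i power_set P i.
have P1' := nbhs_singleton P1.
have nbhsP y i : power_set P i y -> nbhs y (power_set P i.+1).
  move=> Py; have c := @mulgl_continuous R n G (y^-1)%g y.
  have : nbhs y [set z | P (y^-1 * z)%g] by apply: c; rewrite /= mulVg.
  by apply: filterS => z Pz; exists (y, (y^-1 * z)%g); rewrite //= mulVKg.
have oU : open U.
  rewrite openE => y [i _ Py]; apply: filterS (nbhsP _ _ Py) => z Pz.
  by exists i.+1.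
have cU : closed U.
  move=> y cy.
  have c : {for y, continuous (fun z : G => (z^-1 * y)%g)}.
    apply: (@continuous_comp _ _ _ (fun z : G => (z^-1)%g) (fun z => z * y)%g).
      exact: lie_invg_continuous.
    exact: mulgr_continuous.
  have /cy[z [[i _ Pz] /= Pzy]] : nbhs y [set z | P (z^-1 * y)%g].
    by apply: c; rewrite /= mulVg.
  by exists i.+1 => //; exists (z, (z^-1 * y)%g); rewrite //= mulVKg.
have UE : U = setT.
  apply: cG; [|exists U; rewrite ?setTI//..].
  by exists 1%g, 0%N.
by have : U x; [rewrite UE|case=> i _ Px; exists i].
Qed.

End Cutoffs.

(** * The sequence of cutoffs *)

Lemma field_sum (R : realType) (n : nat) (G : lieGroupType R n) (Y : operator G)
    (I : Type) (r : seq I) (F : I -> G -> R) x :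
  vector_field Y -> (forall i, smooth (F i)) ->
  Y (fun x => \sum_(i <- r) F i x) x = \sum_(i <- r) Y (F i) x.
Proof.
move=> vY sF; elim: r => [|i r IH].
  rewrite big_nil (_ : (fun x => _) = cst 0); first exact: field_cst vY.
  by apply/funext => y; rewrite big_nil.
rewrite big_cons -IH -(fieldD x vY (sF i) (smooth_sum r sF)).
by congr (Y _ x); apply/funext => y; rewrite big_cons.
Qed.

Lemma test_functionP (R : realType) (n : nat) (G : lieGroupType R n)
    (f : G -> R) (K : set G) : smooth f -> compact K ->
  (forall x, f x != 0 -> K x) -> test_function f.
Proof.
move=> sf cK fK; split=> //; apply: (subclosed_compact _ cK); first exact: closed_closure.
have clK := lie_compact_closed cK; rewrite closureE => x; apply.
by split.
Qed.

Section CutoffSequence.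
Context (R : realType) (n : nat) (G : lieGroupType R n).
Context (k : nat) (X : 'I_k -> operator G).
Hypothesis X_inv : forall j, left_invariant_field (X j).

Let vX j : vector_field (X j) := (X_inv j).1.

(** First and second derivatives vanish where the function is locally
    constant. *)
Lemma field_near_cst j (g : G -> R) (c : R) x : smooth g ->
  (\forall y \near x, g y = c) -> X j g x = 0.
Proof.
by move=> sg gc; rewrite (field_local (vX j) sg (smooth_cst c) gc) (field_cst _ _ (vX j)).
Qed.

Lemma field2_near_cst j l (g : G -> R) (c : R) x : smooth g ->
  (\forall y \near x, g y = c) -> X j (X l g) x = 0.
Proof.
move=> sg gc; apply: field_eq0 (vX j) (field_smooth (vX l) sg) _.
have : \forall y \near x, \forall z \near y, g z = c by exact: nbhs_interior gc.
by apply: filterS => y; exact: field_near_cst.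
Qed.

Lemma norm_sum_disjoint m (e : 'I_m -> R) (C : R) : 0 <= C ->
  (forall i, `|e i| <= C) -> (forall i i', e i != 0 -> e i' != 0 -> i = i') ->
  `|\sum_i e i| <= C.
Proof.
move=> C0 eC e1; have [[i ei]|noe] := pselect (exists i, e i != 0).
  rewrite (bigD1 i)//= big1 ?addr0// => i' i'i; apply/eqP.
  by apply: contraNT i'i => ei'; apply/eqP; exact: e1.
rewrite big1 ?normr0// => i _; apply/eqP; apply: contrapT => /negP ei.
by apply: noe; exists i.
Qed.

(** The cutoffs chi_m are averages of m + 1 plateau functions whose derivatives
    have disjoint supports and are bounded by the same constant; hence the
    derivatives of chi_m are O(1 / m). *)
Lemma cutoff_sequence : connected [set: G] ->
  exists (C : R) (chi : nat -> G -> R), [/\ 0 <= C,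
    forall m, test_function (chi m),
    forall m x, 0 <= chi m x <= 1,
    forall x, exists M, forall m, (M <= m)%N -> chi m x = 1
    & [/\ forall m j x, `|X j (chi m) x| <= C / m.+1%:R,
          forall m j l x, `|X j (X l (chi m)) x| <= C / m.+1%:R
        & forall m, exists m', forall j x, X j (chi m) x != 0 -> chi m' x = 1]].
Proof.
move=> cG; have [C [P [C0 cP P1 plat]]] := uniform_plateau X_inv.
have P1' := nbhs_singleton P1.
pose L := power_set P.
have cL i : compact (L i) by exact: power_set_compact.
have clL i : closed (L i) by exact: lie_compact_closed.
have leL i j : (i <= j)%N -> L i `<=` L j by exact: power_set_le.
have /choice[eta etaP] i := plat (L (2 * i)%N) (cL _).
have seta i : smooth (eta i) by have [] := etaP i.
have eta01 i x : 0 <= eta i x <= 1 by have [_ + _ _ _] := etaP i; exact.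
have eta1 i x : L (2 * i)%N x -> eta i x = 1 by have [_ _ + _ _] := etaP i; exact.
have eta0 i x : ~ L (2 * i).+1 x -> eta i x = 0.
  move=> nL; have [_ _ _ + _] := etaP i => /(_ x) H.
  by apply/eqP; apply: contrapT => /negP/H.
have near0 i x : ~ L (2 * i).+1 x -> \forall y \near x, eta i y = 0.
  move=> nL; have oL : open (~` L (2 * i).+1) by rewrite openC.
  by apply: filterS (open_nbhs_nbhs (conj oL nL)) => y; exact: eta0.
have near1 i x : L (2 * i).+1 x -> \forall y \near x, eta i.+1 y = 1.
  move=> Lx; have : nbhs x [set y | P (x^-1 * y)%g].
    by apply: (@mulgl_continuous R n G (x^-1)%g x); rewrite /= mulVg.
  apply: filterS => y Py; apply: eta1; rewrite mulnS.
  by exists (x, (x^-1 * y)%g); rewrite //= mulVKg.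
have near1' i i' x : (i < i')%N -> L (2 * i).+1 x -> \forall y \near x, eta i' y = 1.
  case: i' => // i'; rewrite ltnS => ii' Lx; apply: near1.
  by apply: leL Lx; rewrite ltnS leq_mul2l.
have Xe j i x : `|X j (eta i) x| <= C by have [_ _ _ _ [+ _]] := etaP i; exact.
have XXe j l i x : `|X j (X l (eta i)) x| <= C.
  by have [_ _ _ _ [_ +]] := etaP i; exact.
(* chi_m averages eta_i for m < i <= 2 m + 1; the derivatives of eta_i live in
   L (2 i + 1) minus L (2 i - 1), and these sets are disjoint *)
pose a m (i : 'I_m.+1) := (m.+1 + i)%N.
have disj (D : (G -> R) -> R) (x : G) m (i i' : 'I_m.+1) :
    (forall i c, (\forall y \near x, eta i y = c) -> D (eta i) = 0) ->
    D (eta (a m i)) != 0 -> D (eta (a m i')) != 0 -> i = i'.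
  move=> D0; wlog ii' : i i' / (i <= i')%N => [H Di Di'|Di Di'].
    by have [/H->//|/ltnW/H->] := leqP i i'.
  apply/val_inj/eqP; rewrite eqn_leq ii'/= leqNgt; apply/negP => lt.
  have [Lx|nLx] := pselect (L (2 * a m i).+1 x).
    by move: Di'; rewrite (D0 _ 1) ?eqxx//; apply: near1' Lx; rewrite /a ltn_add2l.
  by move: Di; rewrite (D0 _ 0) ?eqxx//; exact: near0.
pose chi m x := m.+1%:R^-1 * \sum_(i < m.+1) eta (a m i) x.
pose sum_eta m x := \sum_(i < m.+1) eta (a m i) x.
have ssum m : smooth (sum_eta m) by apply: smooth_sum => i; exact: seta.
have Xsum m j x : X j (sum_eta m) x = \sum_(i < m.+1) X j (eta (a m i)) x.
  by rewrite /sum_eta (field_sum _ x (vX j))// => i; exact: seta.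
have Xchi m j x : X j (chi m) x = m.+1%:R^-1 * \sum_(i < m.+1) X j (eta (a m i)) x.
  by rewrite (fieldZ _ x (vX j) (ssum m)) Xsum.
have XXchi m j l x : X j (X l (chi m)) x =
    m.+1%:R^-1 * \sum_(i < m.+1) X j (X l (eta (a m i))) x.
  have -> : X l (chi m) = (fun x => m.+1%:R^-1 * X l (sum_eta m) x).
    by apply/funext => y; rewrite Xchi Xsum.
  rewrite (fieldZ _ x (vX j) (field_smooth (vX l) (ssum m))); congr (_ * _).
  rewrite (_ : X l _ = (fun x => \sum_(i < m.+1) X l (eta (a m i)) x)).
    by rewrite (field_sum _ x (vX j))// => i; exact: field_smooth (vX l) (seta _).
  by apply/funext => y; exact: Xsum.
have chi1 m x : L (2 * m.+1)%N x -> chi m x = 1.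
  move=> Lx; rewrite /chi (eq_bigr (fun=> 1)); last first.
    by move=> i _; apply: eta1; apply: leL Lx; rewrite leq_mul2l leq_addr.
  by rewrite sumr_const card_ord mulVf.
have chi0 m x : ~ L (4 * m.+1)%N x -> chi m x = 0.
  move=> nL; rewrite /chi big1 ?mulr0// => i _; apply: eta0 => Lx; apply: nL.
  by apply: leL Lx; rewrite /a; have := ltn_ord i; lia.
have mV0 m : 0 <= m.+1%:R^-1 :> R by rewrite invr_ge0.
exists C, chi; split=> //.
- move=> m; apply: (@test_functionP _ _ _ _ (L (4 * m.+1)%N)) => //.
    exact: smoothZ (ssum m).
  by move=> x; apply: contra_neqP; exact: chi0.
- move=> m x; rewrite /chi mulr_ge0 ?sumr_ge0//=; last first.
    by move=> i _; have /andP[] := eta01 (a m i) x.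
  rewrite mulrC ler_pdivrMr// mul1r.
  apply: (@le_trans _ _ (\sum_(i < m.+1) 1)).
    by apply: ler_sum => i _; have /andP[] := eta01 (a m i) x.
  by rewrite sumr_const card_ord.
- move=> x; have [i Lx] := power_set_exhausts cG P1 x.
  exists i => m im; apply: chi1; apply: leL Lx; lia.
split=> [m j x|m j l x|m].
- rewrite Xchi normrM ger0_norm// mulrC ler_wpM2r//.
  apply: norm_sum_disjoint => // i i'; apply: (disj (fun g => X j g x)) => i0 c.
  exact: field_near_cst (seta _).
- rewrite XXchi normrM ger0_norm// mulrC ler_wpM2r//.
  apply: norm_sum_disjoint => // i i'; apply: (disj (fun g => X j (X l g) x)) => i0 c.
  exact: field2_near_cst (seta _).
exists (2 * m.+1)%N => j x Xx; apply: chi1.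
have [Lx|nLx] := pselect (L (4 * m.+1)%N x); first by apply: leL Lx; lia.
have oL : open (~` L (4 * m.+1)%N) by rewrite openC.
have z0 : \forall y \near x, chi m y = 0.
  by apply: filterS (open_nbhs_nbhs (conj oL nLx)) => y; exact: chi0.
have schi : smooth (chi m) by exact: smoothZ (ssum m).
by move: Xx; rewrite (field_near_cst j schi z0) eqxx.
Qed.

End CutoffSequence.

(** * Borel measurability and measures with a density *)

Lemma continuous_borel_measurable (R : realType) (T : ptopologicalType) (f : T -> R) :
  continuous f -> measurable_fun setT (f : borel T -> R).
Proof.
move=> /continuousP cf; apply: (measurability _ (RGenOpens.measurableE R)).
move=> _ [_ [a [b ->] <-]]; apply: sub_sigma_algebra; rewrite setTI.
exact/cf/interval_open.
Qed.

Lemma continuous_borel_measurable2 (T : ptopologicalType) (f : T -> T) :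
  continuous f -> measurable_fun setT (f : borel T -> borel T).
Proof.
move=> /continuousP cf; apply: (@measurability _ _ (borel T) (borel T) _ _ (@open T)) => //.
move=> _ [A oA <-]; apply: sub_sigma_algebra; rewrite setTI; exact: cf.
Qed.

Lemma closed_borel_measurable (T : ptopologicalType) (A : set T) :
  closed A -> measurable (A : set (borel T)).
Proof.
move=> cA; rewrite -[A]setCK; apply: measurableC; apply: sub_sigma_algebra.
by rewrite /= openC.
Qed.

Section Density.
Local Open Scope ereal_scope.
Context d (T : measurableType d) (R : realType)
  (la mu : {measure set T -> \bar R}) (w : T -> R).
Hypotheses (mw : measurable_fun setT w) (w0 : forall x, (0 <= w x)%R).
Hypothesis muE : forall A, measurable A -> mu A = \int[la]_(x in A) (w x)%:E.

Import HBNNSimple.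

Let integral_density_simple (h : {nnsfun T >-> R}) :
  \int[mu]_x (h x)%:E = \int[la]_x (h x * w x)%:E.
Proof.
have mh y : measurable (h @^-1` [set y]).
  by rewrite -[X in measurable X]setTI; exact: measurable_funP.
have y0 y : range h y -> (0 <= y)%R by move=> [x _ <-]; exact: fun_ge0.
have yi y x : (0 <= y * \1_(h @^-1` [set y]) x)%R.
  have [y0'|y0'] := leP 0%R y; first by rewrite mulr_ge0.
  by rewrite preimage_nnfun0// indicE in_set0 mulr0.
rewrite integralT_nnsfun sintegralE.
transitivity (\int[la]_x (\sum_(y \in range h) (y * \1_(h @^-1` [set y]) x * w x)%:E)).
  rewrite ge0_integral_fsum//; last 2 first.
  - move=> y; apply/measurable_EFinP; apply: measurable_funM => //.
    exact: measurable_funM.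
  - by move=> y x _; rewrite lee_fin mulr_ge0.
  apply: eq_fsbigr => y; rewrite inE => yh.
  rewrite muE// integral_mkcond -ge0_integralZl//; last 3 first.
  - exact/(measurable_restrictT _ _).1/measurable_EFinP/measurable_funTS.
  - by move=> x _; rewrite patchE; case: ifP => // _; rewrite lee_fin.
  - by rewrite lee_fin y0.
  apply: eq_integral => x _; rewrite patchE indicE.
  by case: ifP => _; rewrite ?mulr1 ?mulr0 ?mul0r ?mule0// EFinM.
apply: eq_integral => x _; rewrite fsumEFin//; congr EFin.
by rewrite [in RHS](fimfunE h x) mulr_fsuml.
Qed.

(** Integration against a measure of density w, by approximation with simple
    functions. *)
Lemma ge0_integral_density (f : T -> R) : measurable_fun setT f ->
  (forall x, (0 <= f x)%R) ->
  \int[mu]_x (f x)%:E = \int[la]_x (f x * w x)%:E.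
Proof.
move=> mf f0.
have mEf : measurable_fun setT (EFin \o f) by exact/measurable_EFinP.
pose h := nnsfun_approx measurableT mEf.
have hf x : (h n x)%:E @[n --> \oo] --> (f x)%:E.
  by apply: (cvg_nnsfun_approx measurableT mEf) => // y _; rewrite lee_fin.
have hmu : \int[mu]_x (h n x)%:E @[n --> \oo] --> \int[mu]_x (f x)%:E.
  have -> : \int[mu]_x (f x)%:E = \int[mu]_x lim ((h n x)%:E @[n --> \oo]).
    by apply: eq_integral => x _; apply/esym/cvg_lim.
  apply: cvg_monotone_convergence => //.
  - by move=> n; apply/measurable_EFinP; exact: measurable_funP.
  - by move=> n x _; rewrite lee_fin.
  - by move=> x _ m n mn; rewrite lee_fin; exact/lefP/nd_nnsfun_approx.
have hla : \int[la]_x (h n x * w x)%:E @[n --> \oo] --> \int[la]_x (f x * w x)%:E.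
  have -> : \int[la]_x (f x * w x)%:E = \int[la]_x lim ((h n x * w x)%:E @[n --> \oo]).
    apply: eq_integral => x _; apply/esym/cvg_lim => //.
    have := hf x; move/fine_cvgP => [_ hfx]; apply: cvg_EFin; first by near=> n.
    by apply: cvgM; [exact: hfx|exact: cvg_cst].
  apply: cvg_monotone_convergence => //.
  - move=> n; apply/measurable_EFinP; apply: measurable_funM => //.
  - by move=> n x _; rewrite lee_fin mulr_ge0.
  - move=> x _ m n mn; rewrite lee_fin ler_wpM2r//.
    exact/lefP/nd_nnsfun_approx.
have hE : (fun n => \int[mu]_x (h n x)%:E) = (fun n => \int[la]_x (h n x * w x)%:E).
  by apply/funext => n; exact: integral_density_simple.
by rewrite hE in hmu; exact: (cvg_unique _ hmu hla).
Unshelve. all: by end_near. Qed.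

Lemma integral_density (f : T -> R) : measurable_fun setT f ->
  la.-integrable setT (fun x => (f x * w x)%:E) ->
  \int[mu]_x (f x)%:E = \int[la]_x (f x * w x)%:E.
Proof.
move=> mf fw.
rewrite integralE [RHS]integralE; congr (_ - _).
  transitivity (\int[mu]_x (Num.max (f x) 0)%:E).
    by apply: eq_integral => x _; rewrite funeposE EFin_max.
  rewrite ge0_integral_density//; last 2 first.
  - exact: measurable_maxr.
  - by move=> x; rewrite le_max lexx orbT.
  apply: eq_integral => x _; rewrite funeposE -EFin_max maxr_pMl// ?mul0r//.
transitivity (\int[mu]_x (Num.max (- f x) 0)%:E).
  by apply: eq_integral => x _; rewrite funenegE EFin_max.
rewrite ge0_integral_density//; last 2 first.
- by apply: measurable_maxr => //; exact: measurableT_comp.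
- by move=> x; rewrite le_max lexx orbT.
by apply: eq_integral => x _; rewrite funenegE -EFin_max maxr_pMl// mul0r mulNr.
Qed.

End Density.

(** * Translation invariance and the divergence formula *)

Section HaarIntegral.
Context (R : realType) (n : nat) (G : lieGroupType R n).
Context (lambda : {measure set (borel G) -> \bar R}).
Implicit Types (K : set G) (h : G -> R).

Lemma compact_support_integrable (m : {measure set (borel G) -> \bar R}) K
    (h : G -> R) : compact K -> (m K < +oo)%E -> continuous h ->
  (forall x, ~ K x -> h x = 0) -> m.-integrable setT (EFin \o (h : borel G -> R)).
Proof.
move=> cK mK ch h0.
have mKs : measurable (K : set (borel G)).
  exact: closed_borel_measurable (lie_compact_closed cK).
have mh := continuous_borel_measurable ch.
have -> : EFin \o (h : borel G -> R) = (EFin \o (h : borel G -> R)) \_ K.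
  apply/funext => x; rewrite patchE; case: ifPn => //=.
  by rewrite notin_setE => /h0 ->.
apply/(integrable_mkcond _ mKs).1.
apply: measurable_bounded_integrable => //; first exact: measurable_funTS.
have [C C0 hC] := compact_continuous_bounded cK ch.
exists C; split; first exact: num_real.
by move=> M CM x Kx; apply: le_trans (hC x Kx) _; exact: ltW.
Qed.

Hypothesis lambda_haar : haar_measure lambda.

(** Right translations preserve the integral. *)
Lemma haar_translate (a : G) h K : compact K -> continuous h ->
  (forall x, ~ K x -> h x = 0) ->
  (\int[lambda]_x (h (x * a)%g)%:E = \int[lambda]_x (h x)%:E)%E.
Proof.
move=> cK ch h0; have [_ fin inv] := lambda_haar.
pose t : borel G -> borel G := fun x : G => (x * a)%g.
have mt : measurable_fun setT t.
  by apply: continuous_borel_measurable2; exact: mulgr_continuous.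
have mh := continuous_borel_measurable ch.
pose K' : set G := (fun x : G => (x * a^-1)%g) @` K.
have cK' : compact K'.
  by apply: continuous_compact cK; apply: continuous_subspaceT; exact: mulgr_continuous.
have ih : lambda.-integrable setT (EFin \o (fun x : borel G => h (x * a)%g)).
  apply: (@compact_support_integrable lambda K') => //; first exact: fin.
    by move=> x; apply: continuous_comp; [exact: mulgr_continuous|exact: ch].
  move=> x nKx; apply: h0 => Kxa; apply: nKx.
  by exists (x * a)%g => //; rewrite mulgK.
have := @integral_pushforward _ _ _ _ R t mt lambda setT (EFin \o (h : borel G -> R)).
rewrite preimage_setT => <- //; last exact/measurable_EFinP.
apply: eq_measure_integral => A mA _; rewrite -[LHS]/(lambda (t @^-1` A)).
have -> : t @^-1` A = [set (x * a^-1)%g | x in A].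
  apply/seteqP; split=> [x Ax|_ [x Ax <-]].
    by exists (x * a)%g => //; rewrite mulgK.
  by rewrite /preimage/= /t mulgVK.
by have [_ ->] := inv A a^-1%g mA.
Qed.

End HaarIntegral.

Section InvariantDerivative.
Context (R : realType) (n : nat) (G : lieGroupType R n).
Context (lambda : {measure set (borel G) -> \bar R}).
Hypothesis lambda_haar : haar_measure lambda.
Context (Y : operator G).
Hypothesis Y_inv : left_invariant_field Y.

(** Y h (x) is the derivative at t = 0 of h (x gamma(t)) for a fixed curve gamma
    issued from 1, a segment in a chart. The difference quotients have
    integral 0 by invariance of lambda under right translations; by the mean
    value theorem and joint smoothness of the multiplication they are bounded
    on a compact set K' outside which they vanish, so that dominated
    convergence applies. *)
Lemma haar_integral_field (h : G -> R) (K : set G) : smooth h -> compact K ->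
  (forall x, ~ K x -> h x = 0) -> (\int[lambda]_x (Y h x)%:E = 0)%E.
Proof.
move=> sh cK h0; have [_ fin _] := lambda_haar.
have [[tY _] _] := Y_inv; have [c [v [ac c1 YE]]] := tY 1%g.
set q0 := chart_fun c 1%g in YE.
pose F (x : G) (q : 'rV[R]_n) := h (x * chart_inv c q)%g.
have F_C1 x : Ck 1 (chart_range c) (F x).
  exact: smooth_Ck 1 (smooth_translate x sh) ac.
have YF x : Y h x = 'D_v (F x) q0.
  by rewrite (invariant_field_at1 x Y_inv sh) (YE _ (smooth_translate x sh)).
have := open_nbhs_nbhs (conj (chart_range_open c) (chart_fun_range c1)).
move=> /nbhs_ballP[e /= e0 ce].
set r := e / 2; have r0 : 0 < r by rewrite divr_gt0.
pose B : set 'rV[R]_n := [set y | `|y - q0| <= r].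
have BR : B `<=` chart_range c.
  move=> y By; apply: ce; rewrite -ball_normE /ball_ /= distrC.
  by rewrite (le_lt_trans By)// /r ltr_pdivrMr// ltr_pMr// ltr1n.
pose P := chart_inv c @` B.
have cP : compact P.
  apply: continuous_compact; last exact: rV_ball_compact.
  apply: continuous_in_subspaceT => y.
  by rewrite inE => /BR; exact: chart_inv_continuous.
have P1 : P 1%g.
  by exists q0; [rewrite /B /= subrr normr0 ltW|exact: chart_funK].
pose K' : set G := (fun p : G * G => (p.1 * p.2^-1)%g) @` (K `*` P).
have cK' : compact K'.
  apply: continuous_compact; last exact: compact_setX.
  apply: continuous_subspaceT => p.
  apply: (@continuous_comp _ _ _ (fun p : G * G => (p.1, p.2^-1)%g)
    (fun p : G * G => (p.1 * p.2)%g)); last exact: lie_mulg_continuous.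
  apply: cvg_pair; first exact: cvg_fst.
  apply: (@continuous_comp _ _ _ snd (fun x : G => (x^-1)%g)); first exact: cvg_snd.
  exact: lie_invg_continuous.
have F0 x q : ~ K' x -> B q -> F x q = 0.
  move=> nKx Bq; apply: h0 => Kxq; apply: nKx.
  exists ((x * chart_inv c q)%g, chart_inv c q); last by rewrite /= mulgK.
  by split=> //; exists q.
have nearB : \forall M \near +oo, forall t : R, `|t| <= M^-1 -> B (t *: v + q0).
  apply: filterS (filterI (nbhs_pinfty_gt (num_real 0))
    (nbhs_pinfty_ge (num_real (`|v| / r)))) => M [M0 vM] t tM.
  rewrite /B /= addrK normrZ.
  apply: (@le_trans _ _ (M^-1 * `|v|)); first exact: ler_wpM2r.
  by rewrite ler_pdivrMl// -ler_pdivrMr.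
(* The parameter M serves both as a bound on the derivative and, through its
   inverse, as the length of the curve, so that compactness yields both. *)
have bound (x0 : G) : \forall x' \near x0 & M \near +oo,
    forall t : R, `|t| <= M^-1 -> `|'D_v (F x') (t *: v + q0)| <= M.
  have [d ad dx0] := atlas_cover x0.
  pose J (p : 'rV[R]_n * 'rV[R]_n) := h (chart_inv d p.1 * chart_inv c p.2)%g.
  have CJ := smooth_mul_joint 1 sh ad ac.
  have FJ x q : chart_dom d x -> 'D_v (F x) q = 'D_(0, v) J (chart_fun d x, q).
    move=> dx; have -> : F x = (fun q => J (chart_fun d x, q)).
      by apply/funext => q'; rewrite /F /J /= chart_funK.
    by rewrite /derive derive_sliceE.
  have cJ : {for (chart_fun d x0, q0), continuous ('D_(0, v) J)}.
    apply: Ck_continuous (Ck_derive (0, v) CJ) _.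
    by split; [exact: chart_fun_range|exact: chart_fun_range].
  set b := `|'D_(0, v) J (chart_fun d x0, q0)| + 1.
  have nJ : \forall p \near (chart_fun d x0, q0), `|'D_(0, v) J p| <= b.
    have /cvgrPdist_le/(_ 1 ltr01) := cJ; apply: filterS => p Jp.
    rewrite /b -lerBlDl (le_trans (lerB_dist _ _))// distrC.
    exact: Jp.
  have [[A1 A2] /= [A1d A2q] A12] := nJ.
  have /nbhs_ballP[eps /= eps0 epsA] := A2q.
  exists ([set x | chart_dom d x /\ A1 (chart_fun d x)],
          [set M | [/\ 0 < M, b <= M & `|v| < M * eps]]) => /=.
    split.
      apply: filterI.
        exact: open_nbhs_nbhs (conj (chart_dom_open d) dx0).
      exact: (chart_fun_continuous dx0).
    apply: filterS (filterI (nbhs_pinfty_gt (num_real 0))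
      (filterI (nbhs_pinfty_ge (num_real b))
        (nbhs_pinfty_gt (num_real (`|v| / eps))))) => M [M0 [bM vM]].
    by split=> //; rewrite -ltr_pdivrMr.
  move=> [x M] /= [[dx A1x] [M0 bM vM]] t tM.
  rewrite FJ// (le_trans _ bM)//; apply: (A12 (_, _)); split => //.
  apply: epsA; rewrite -ball_normE /ball_ /= opprD addrCA subrr addr0 normrN normrZ.
  apply: (@le_lt_trans _ _ (M^-1 * `|v|)); first exact: ler_wpM2r.
  by rewrite ltr_pdivrMl.
have /compact_near_coveringP := cK'.
move=> /(_ R +oo (fun M x => forall t : R, `|t| <= M^-1 ->
  `|'D_v (F x) (t *: v + q0)| <= M)) /(_ _ (fun x _ => bound x)) boundK.
have [M [[M0 MB] MK]] : exists M : R, (0 < M /\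
    forall t : R, `|t| <= M^-1 -> B (t *: v + q0)) /\
    forall x, K' x -> forall t : R, `|t| <= M^-1 ->
      `|'D_v (F x) (t *: v + q0)| <= M.
  have := filter_ex (filterI (filterI (nbhs_pinfty_gt (num_real 0)) nearB) boundK).
  by move=> [M [H1 H2]]; exists M.
pose t_ (m : nat) : R := M^-1 / m.+1%:R.
have t_gt0 m : 0 < t_ m by rewrite /t_ divr_gt0// invr_gt0.
have t_le m : t_ m <= M^-1.
  by rewrite /t_ ler_pdivrMr// ler_pMr ?invr_gt0// ler1n.
have t_cvg0 : t_ @ \oo --> (0 : R)^'.
  have t0 : t_ @ \oo --> (0 : R).
    rewrite -[X in _ --> X](mulr0 M^-1); apply: cvgMl_tmp.
    exact: (@cvg_harmonic R).
  move=> A A0; have : \forall m \near \oo, t_ m != 0 -> A (t_ m) by exact: t0 A0.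
  rewrite nbhs_simpl /=; apply: filterS => m; apply.
  by rewrite (gt_eqF (t_gt0 m)).
pose a m := chart_inv c (t_ m *: v + q0).
pose g m (x : borel G) : R := (t_ m)^-1 * (h (x * a m)%g - h x).
have Bt m : B (t_ m *: v + q0) by apply: MB; rewrite (ger0_norm (ltW (t_gt0 m))).
have Bq0 : B q0 by rewrite /B /= subrr normr0 ltW.
have FE x : h x = F x q0 by rewrite /F chart_funK// mulg1.
have g_off m x : ~ K' x -> g m x = 0.
  move=> nKx; rewrite /g (FE x) -/(F x (t_ m *: v + q0)) !F0// subrr mulr0//.
have g_le m x : `|g m x| <= M * \1_K' x.
  have [Kx|nKx] := pselect (K' x); last by rewrite g_off// normr0 mulr_ge0// ltW.
  rewrite indicE mem_set// mulr1.
  have scale_le (s : R) : 0 <= s <= 1 -> `|s * t_ m| <= M^-1.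
    move=> /andP[s0 s1]; rewrite ger0_norm; last by rewrite mulr_ge0 ?(ltW (t_gt0 m)).
    by rewrite (le_trans _ (t_le m))// ler_piMl// (ltW (t_gt0 m)).
  have dF (s : R) w : 0 <= s <= 1 -> derivable (F x) (s *: (t_ m *: v) + q0) w.
    move=> s01; apply: Ck_derivable (F_C1 x) _; apply: BR.
    by rewrite scalerA; apply: MB; exact: scale_le.
  have [s s01 sE] := mean_value_direction (fun s s01 => dF s (t_ m *: v) s01).
  rewrite /g (FE x) -/(F x (t_ m *: v + q0)) sE.
  have [_ ->] := is_derive_scale (t_ m) (dF s v s01).
  rewrite mulKf ?(gt_eqF (t_gt0 m))// scalerA; by apply: MK => //; exact: scale_le.
have ch := smooth_continuous sh.
have mh := continuous_borel_measurable ch.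
have cha m : continuous (fun x : G => h (x * a m)%g).
  by move=> x; apply: continuous_comp; [exact: mulgr_continuous|exact: ch].
have ih : lambda.-integrable setT (EFin \o (h : borel G -> R)).
  exact: compact_support_integrable cK (fin _ cK) ch h0.
have iha m : lambda.-integrable setT (EFin \o (fun x : borel G => h (x * a m)%g)).
  apply: (compact_support_integrable cK' (fin _ cK') (cha m)) => x nKx.
  exact: F0 nKx (Bt m).
have int_g m : (\int[lambda]_x (g m x)%:E = 0)%E.
  under eq_integral do rewrite EFinM EFinB.
  rewrite integralZl//; last exact: (integrableB measurableT (iha m) ih).
  rewrite (integralB measurableT (iha m) ih).
  rewrite (haar_translate lambda_haar (a m) cK ch h0) subee ?mule0//.
  exact: integrable_fin_num ih.
have mK' : measurable (K' : set (borel G)).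
  exact: closed_borel_measurable (lie_compact_closed cK').
have mYh := continuous_borel_measurable (smooth_continuous (field_smooth Y_inv.1 sh)).
have mg m : measurable_fun setT (g m).
  apply: measurable_funM => //; apply: measurable_funB => //.
  exact: continuous_borel_measurable (cha m).
have g_cvg (x : borel G) : g m x @[m --> \oo] --> Y h x.
  have dF : derivable (F x) q0 v by exact: Ck_derivable (F_C1 x) (BR _ Bq0).
  rewrite YF; pose Q (s : R) := s^-1 *: ((F x \o shift q0) (s *: v) - F x q0).
  have gQ : (fun m => g m x) = Q \o t_.
    by apply/funext => m; rewrite /g (FE x).
  by rewrite gQ; exact: cvg_comp t_cvg0 dF.
have [] := @dominated_convergence _ _ R lambda setT measurableT
  (fun m x => (g m x)%:E) (fun x => (Y h x)%:E) (fun x => (M * \1_K' x)%:E).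
- by move=> m; apply/measurable_EFinP.
- exact/measurable_EFinP.
- by apply: aeW => x _; apply: cvg_EFin; [exact: nearW|exact: g_cvg].
- have -> : (fun x : borel G => (M * \1_K' x)%:E) = (EFin \o cst M) \_ K'.
    apply/funext => x; rewrite patchE indicE.
    by case: ifP => _; rewrite ?mulr1 ?mulr0.
  apply/(integrable_mkcond _ mK').1; apply: measurable_bounded_integrable => //.
    exact: fin.
  by exists `|M|; split; [exact: num_real|move=> N MN x _; exact: ltW].
- by apply: aeW => x m _; rewrite lee_fin.
move=> _ _; rewrite [X in X @ _ --> _](_ : _ = cst 0%E); last first.
  by apply/funext => m; exact: int_g.
by move/cvg_lim => <- //; rewrite lim_cst.
Qed.
End InvariantDerivative.

(** * Test functions and integration by parts *)

Section TestFunctions.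
Context (R : realType) (n : nat) (G : lieGroupType R n).
Implicit Types (f g h : G -> R).

Lemma test_smooth f : test_function f -> smooth f.
Proof. by case. Qed.

Lemma test_off f : test_function f ->
  exists2 K : set G, compact K & forall x, ~ K x -> f x = 0.
Proof.
move=> [_ cK]; exists (closure [set x | f x != 0]) => // x nKx.
by apply/eqP; apply: contrapT => /negP fx; apply: nKx; exact: subset_closure.
Qed.

Lemma testP f K : smooth f -> compact K -> (forall x, ~ K x -> f x = 0) ->
  test_function f.
Proof.
move=> sf cK f0; apply: (test_functionP sf cK) => x fx.
by apply: contrapT => /f0 fx0; rewrite fx0 eqxx in fx.
Qed.

Lemma testM f g : test_function f -> smooth g -> test_function (f \* g).
Proof.
move=> tf sg; have [K cK f0] := test_off tf.
apply: testP (smoothM (test_smooth tf) sg) cK _ => x /f0 fx0.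
by rewrite /= fx0 mul0r.
Qed.

Lemma testMr f g : smooth f -> test_function g -> test_function (f \* g).
Proof.
move=> sf tg; have := testM tg sf; congr test_function.
by apply/funext => x /=; rewrite mulrC.
Qed.

Lemma testD f g : test_function f -> test_function g -> test_function (f \+ g).
Proof.
move=> tf tg; have [K cK f0] := test_off tf; have [L cL g0] := test_off tg.
apply: testP (smoothD (test_smooth tf) (test_smooth tg)) (compactU cK cL) _.
by move=> x /not_orP[/f0 fx0 /g0 gx0]; rewrite /= fx0 gx0 addr0.
Qed.

Lemma testZ (a : R) f : test_function f -> test_function (fun x => a * f x).
Proof. by move=> tf; exact: testMr (smooth_cst a) tf. Qed.

Lemma testB f g : test_function f -> test_function g -> test_function (f \- g).
Proof.
move=> tf tg; have := testD tf (testZ (-1) tg); congr test_function.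
by apply/funext => x /=; rewrite mulN1r.
Qed.

Lemma test_sum (I : Type) (r : seq I) (F : I -> G -> R) :
  (forall i, test_function (F i)) ->
  test_function (fun x => \sum_(i <- r) F i x).
Proof.
move=> tF; elim: r => [|i r IH].
  apply: (@testP _ set0); last by move=> x _; rewrite big_nil.
    by apply: smooth_sum => i; exact: test_smooth.
  exact: compact0.
have := testD (tF i) IH; congr test_function.
by apply/funext => x; rewrite big_cons.
Qed.

Lemma test_field (Y : operator G) f : vector_field Y -> test_function f ->
  test_function (Y f).
Proof.
move=> vY tf; have [K cK f0] := test_off tf.
apply: (testP (field_smooth vY (test_smooth tf)) cK) => x nKx.
apply: (field_eq0 vY (test_smooth tf)).
have oK : open (~` K) by rewrite openC; exact: lie_compact_closed cK.
by apply: filterS (open_nbhs_nbhs (conj oK nKx)) => y; exact: f0.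
Qed.

End TestFunctions.

Section IntegrationByParts.
Context (R : realType) (n : nat) (G : lieGroupType R n).
Context (lambda : {measure set (borel G) -> \bar R}).
Hypothesis lambda_haar : haar_measure lambda.
Context (U : G -> R).
Hypothesis U_smooth : smooth U.
Context (mu : probability (borel G) R).
Hypothesis muE : forall A : set (borel G), measurable A ->
  mu A = (\int[lambda]_(x in A) (expR (- U x))%:E)%E.
Implicit Types (f g h : G -> R).

Lemma smooth_expRN : smooth (fun x => expR (- U x)).
Proof.
have := smooth_expR (smoothZ (-1) U_smooth); congr smooth.
by apply/funext => x; rewrite mulN1r.
Qed.

Lemma test_integrable (m : {measure set (borel G) -> \bar R}) f :
  (forall K : set G, compact K -> (m K < +oo)%E) ->
  test_function f -> m.-integrable setT (EFin \o (f : borel G -> R)).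
Proof.
move=> fin tf; have [K cK f0] := test_off tf.
apply: (compact_support_integrable cK (fin _ cK) _ f0).
exact: smooth_continuous (test_smooth tf).
Qed.

Lemma probability_finite (K : set G) : compact K -> (mu K < +oo)%E.
Proof.
move=> cK; apply: (@le_lt_trans _ _ 1%E); last exact: ltry.
apply: probability_le1; exact: closed_borel_measurable (lie_compact_closed cK).
Qed.

Lemma test_mu_integrable f : test_function f ->
  mu.-integrable setT (EFin \o (f : borel G -> R)).
Proof. by apply: test_integrable; exact: probability_finite. Qed.

(** The divergence formula for mu: apply haar_integral_field to h exp(-U). *)
Lemma field_test_integral (Y : operator G) h : left_invariant_field Y ->
  test_function h ->
  \int[mu]_x (Y h x - h x * Y U x) = 0.
Proof.
move=> Y_inv th; have vY := Y_inv.1.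
have sh := test_smooth th.
have [_ fin _] := lambda_haar.
pose F := Y h \- (h \* Y U).
have tF : test_function F.
  apply: testB (test_field vY th) _; apply: testM th _.
  exact: field_smooth vY U_smooth.
have the : test_function (h \* (fun x => expR (- U x))) by exact: testM th smooth_expRN.
have FE : (fun x => F x * expR (- U x)) = Y (h \* (fun x => expR (- U x))).
  apply/funext => x; rewrite (fieldM x vY sh smooth_expRN).
  have -> : (fun x => expR (- U x)) = (fun x => expR (-1 * U x)).
    by apply/funext => y; rewrite mulN1r.
  rewrite (field_expR x vY (smoothZ (-1) U_smooth)) (fieldZ (-1) x vY U_smooth).
  by rewrite !mulN1r /F /=; ring.
rewrite /Rintegral (@integral_density _ _ _ lambda mu (fun x => expR (- U x))).
- have -> : (fun x : borel G => ((Y h x - h x * Y U x) * expR (- U x))%:E) =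
     (fun x : borel G => (Y (h \* (fun x => expR (- U x))) x)%:E).
    by rewrite -FE.
  have [K cK h0] := test_off the.
  by rewrite (haar_integral_field lambda_haar Y_inv (test_smooth the) cK h0).
- exact: continuous_borel_measurable (smooth_continuous smooth_expRN).
- by move=> x; exact: expR_ge0.
- exact: muE.
- exact: continuous_borel_measurable (smooth_continuous (test_smooth tF)).
- have := test_integrable fin (test_field vY the).
  by rewrite -FE.
Qed.

End IntegrationByParts.

(** * The quadratic form on test functions *)

Section SkewFields.
Context (R : realType) (n : nat) (G : lieGroupType R n).
Context (k : nat) (X : 'I_k -> operator G).
Hypothesis X_inv : forall j, left_invariant_field (X j).
Context (U : G -> R).
Hypothesis U_smooth : smooth U.
Implicit Types (f g h chi : G -> R).

Let vX j : vector_field (X j) := (X_inv j).1.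

Local Notation VU := (V X U).

Lemma V_Leibniz j chi f : smooth chi -> smooth f ->
  VU j (chi \* f) = (chi \* VU j f) \+ (X j chi \* f).
Proof.
by move=> sc sf; apply/funext => x; rewrite /V /= (fieldM x (vX j) sc sf); ring.
Qed.

Lemma V_smooth j f : smooth f -> smooth (VU j f).
Proof.
move=> sf; apply: smoothB (field_smooth (vX j) sf) _.
exact: smoothM (smoothZ 2^-1 (field_smooth (vX j) U_smooth)) sf.
Qed.

Lemma V_test j f : test_function f -> test_function (VU j f).
Proof.
move=> tf; apply: testB (test_field (vX j) tf) _.
exact: testMr (smoothZ 2^-1 (field_smooth (vX j) U_smooth)) tf.
Qed.

Lemma V_sub j f g : smooth f -> smooth g -> VU j (f \- g) = VU j f \- VU j g.
Proof.
move=> sf sg; apply/funext => x.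
by rewrite /V /= (fieldB x (vX j) sf sg); ring.
Qed.

Let E x : R := expR (2^-1 * U x).
Let E' x : R := expR (- 2^-1 * U x).

Let EE' f : E' \* (E \* f) = f.
Proof.
apply/funext => x; rewrite /= mulrA /E /E' -expRD mulNr addNr expR0.
by rewrite mul1r.
Qed.

Let sE : smooth E.
Proof. exact: smooth_expR (smoothZ _ U_smooth). Qed.

Let sE' : smooth E'.
Proof. exact: smooth_expR (smoothZ _ U_smooth). Qed.

(* V_j is conjugate to X_j by the multiplication by exp(U/2). *)
Let V_conj j f : smooth f -> VU j f = E \* X j (E' \* f).
Proof.
move=> sf; apply/funext => x; rewrite /= (fieldM x (vX j) sE' sf).
rewrite (field_expR x (vX j) (smoothZ (- 2^-1) U_smooth)).
rewrite (fieldZ (- 2^-1) x (vX j) U_smooth) /V.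
have EE : E x * E' x = 1 by rewrite /E /E' -expRD mulNr subrr expR0.
rewrite -/(E' x).
rewrite [RHS](_ : _ = (E x * E' x) * (X j f x - 2^-1 * X j U x * f x)); last by ring.
by rewrite EE mul1r.
Qed.

(** After conjugation this is the vanishing of the commutators of the X_j of
    length three. *)
Lemma bracket_V_comm j l m f : lie_nilpotent_of_order G 2 -> smooth f ->
  bracket (VU j) (VU l) (VU m f) = VU m (bracket (VU j) (VU l) f).
Proof.
move=> nil sf.
have sX i g : smooth g -> smooth (X i g) by exact: field_smooth (vX i).
have VVV a b c : VU a (VU b (VU c f)) = E \* X a (X b (X c (E' \* f))).
  have s1 := sX c _ (smoothM sE' sf); have s2 := sX b _ s1.
  rewrite (V_conj c sf) (V_conj b (smoothM sE s1)) (EE' (X c (E' \* f))).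
  by rewrite (V_conj a (smoothM sE s2)) (EE' (X b (X c (E' \* f)))).
have sVV a b : smooth (VU a (VU b f)) by do 2 apply: V_smooth; exact: sf.
rewrite /bracket (V_sub m (sVV j l) (sVV l j)).
rewrite !VVV; set g := E' \* f.
have sg : smooth g := smoothM sE' sf.
pose Z i := if i is i'.+1 then (if i' is _.+1 then X m else X l) else X j.
have Z_inv i : left_invariant_field (Z i) by case: i => [|[|i]]; exact: X_inv.
have /(congr1 (fun h : G -> R => h)) := nil Z Z_inv g sg.
rewrite /= /bracket => nilg; apply/funext => x /=.
have := congr1 (fun h : G -> R => h x) nilg.
rewrite /= (fieldB x (vX m) (sX _ _ (sX _ _ sg)) (sX _ _ (sX _ _ sg))) => e0.
by apply/eqP; rewrite -!mulrBr -subr_eq0 -mulrBr e0 mulr0.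
Qed.

End SkewFields.

Section DotProduct.
Context (R : realType) (n : nat) (G : lieGroupType R n).
Context (mu : probability (borel G) R).
Implicit Types (f g h : G -> R).

Lemma dotC f g : dot mu f g = dot mu g f.
Proof. by apply: eq_Rintegral => x _; rewrite mulrC. Qed.

Let integ f g : test_function f -> smooth g ->
  mu.-integrable setT (EFin \o (fun x : borel G => f x * g x)).
Proof. by move=> tf sg; exact: test_mu_integrable (testM tf sg). Qed.

Lemma dotBl f g h : test_function f -> test_function g -> smooth h ->
  dot mu (f \- g) h = dot mu f h - dot mu g h.
Proof.
move=> tf tg sh; rewrite /dot -(RintegralB measurableT (integ tf sh) (integ tg sh)).
by apply: eq_Rintegral => x _ /=; rewrite mulrBl.
Qed.

Lemma dotBr f g h : test_function f -> smooth g -> smooth h ->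
  dot mu f (g \- h) = dot mu f g - dot mu f h.
Proof.
move=> tf sg sh; rewrite /dot -(RintegralB measurableT (integ tf sg) (integ tf sh)).
by apply: eq_Rintegral => x _ /=; rewrite mulrBr.
Qed.

Lemma dotDl f g h : test_function f -> test_function g -> smooth h ->
  dot mu (f \+ g) h = dot mu f h + dot mu g h.
Proof.
move=> tf tg sh; rewrite /dot -(RintegralD measurableT (integ tf sh) (integ tg sh)).
by apply: eq_Rintegral => x _ /=; rewrite mulrDl.
Qed.

Lemma dotNl f h : test_function f -> smooth h ->
  dot mu (fun x => - f x) h = - dot mu f h.
Proof.
move=> tf sh; rewrite /dot -[RHS]mulN1r -(RintegralZl _ measurableT (integ tf sh)).
by apply: eq_Rintegral => x _ /=; rewrite mulNr mulN1r.
Qed.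

Lemma dot_suml (I : Type) (r : seq I) (F : I -> G -> R) h :
  (forall i, test_function (F i)) -> smooth h ->
  dot mu (fun x => \sum_(i <- r) F i x) h = \sum_(i <- r) dot mu (F i) h.
Proof.
move=> tF sh; elim: r => [|i r IH].
  rewrite big_nil /dot (eq_Rintegral _ (g := cst 0)); last first.
    by move=> x _; rewrite big_nil mul0r.
  by rewrite Rintegral_cst// mul0r.
rewrite big_cons -IH -(dotDl (tF i) (test_sum r tF) sh).
by apply: eq_Rintegral => x _; rewrite big_cons.
Qed.

Lemma dot_ge0 f : 0 <= dot mu f f.
Proof. by apply: Rintegral_ge0 => x _; rewrite -expr2 sqr_ge0. Qed.

End DotProduct.

Section QuadraticForm.
Context (R : realType) (n : nat) (G : lieGroupType R n).
Context (lambda : {measure set (borel G) -> \bar R}).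
Hypothesis lambda_haar : haar_measure lambda.
Context (k : nat) (X : 'I_k -> operator G).
Hypothesis X_inv : forall j, left_invariant_field (X j).
Context (U : G -> R).
Hypothesis U_smooth : smooth U.
Context (mu : probability (borel G) R).
Hypothesis muE : forall A : set (borel G), measurable A ->
  mu A = (\int[lambda]_(x in A) (expR (- U x))%:E)%E.
Hypothesis order2 : lie_nilpotent_of_order G 2.
Implicit Types (f g h : G -> R).

Let vX j : vector_field (X j) := (X_inv j).1.

Local Notation VU := (V X U).
Local Notation "<< f , g >>" := (dot mu f g).

Let tV j f : test_function f -> test_function (VU j f) :=
  @V_test _ _ _ _ _ X_inv _ U_smooth j f.
Let sV j f : smooth f -> smooth (VU j f) :=
  @V_smooth _ _ _ _ _ X_inv _ U_smooth j f.

(** V_j is skew-symmetric with respect to mu. *)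
Lemma V_skew j f g : test_function f -> smooth g ->
  << VU j f, g >> = - << f, VU j g >>.
Proof.
move=> tf sg; apply/eqP; rewrite -addr_eq0; apply/eqP.
have sf := test_smooth tf.
rewrite /dot -RintegralD//; last 2 first.
- exact: test_mu_integrable (testM (tV j tf) sg).
- exact: test_mu_integrable (testM tf (sV j sg)).
rewrite -[RHS](field_test_integral lambda_haar U_smooth muE (X_inv j) (testM tf sg)).
apply: eq_Rintegral => x _.
by rewrite (fieldM x (vX j) sf sg) /V /=; field.
Qed.

Let Z j l f := bracket (VU j) (VU l) f.

Let tZ j l f : test_function f -> test_function (Z j l f).
Proof. by move=> tf; apply: testB; apply: tV; exact: tV. Qed.

Lemma bracket_skew j l f g : test_function f -> smooth g ->
  << Z j l f, g >> = - << f, Z j l g >>.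
Proof.
move=> tf sg; rewrite /Z /bracket.
rewrite (dotBl mu (tV _ (tV _ tf)) (tV _ (tV _ tf)) sg).
rewrite (V_skew j (tV l tf) sg) (V_skew l tf (sV j sg)).
rewrite (V_skew l (tV j tf) sg) (V_skew j tf (sV l sg)).
rewrite (dotBr mu tf (sV j (sV l sg)) (sV l (sV j sg))).
by rewrite !opprK opprB.
Qed.

(* Integrations by parts, and the fact that the bracket Z = [V_j, V_l]
   commutes with V_j:
   (V_j V_l g, V_l V_j g) = (V_l^2 g, V_j^2 g) + (V_j V_l g, Z g). *)
Let dot_cross j l g : test_function g ->
  2 * << VU j (VU l g), VU l (VU j g) >> =
  << VU l (VU l g), VU j (VU j g) >> + << VU j (VU l g), VU j (VU l g) >>.
Proof.
move=> tg; have sg := test_smooth tg.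
have tVl := tV l tg; have tVj := tV j tg.
have tVjl := tV j tVl; have tVlj := tV l tVj.
have e1 := V_skew j tVl (test_smooth tVlj).
have e2 := V_skew l tVl (test_smooth (tV j tVj)).
have e3 : << VU l g, Z j l (VU j g) >> =
    << VU l g, VU j (VU l (VU j g)) >> - << VU l g, VU l (VU j (VU j g)) >>.
  exact: (dotBr mu tVl (test_smooth (tV j tVlj)) (test_smooth (tV l (tV j tVj)))).
have e4 : << VU l g, Z j l (VU j g) >> = - << VU j (VU l g), Z j l g >>.
  by rewrite /Z (bracket_V_comm X_inv U_smooth j l j order2 sg)
    (V_skew j tVl (test_smooth (tZ j l tg))) opprK.
have e5 : << VU j (VU l g), Z j l g >> =
    << VU j (VU l g), VU j (VU l g) >> - << VU j (VU l g), VU l (VU j g) >>.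
  exact: (dotBr mu tVjl (test_smooth tVjl) (test_smooth tVlj)).
lra.
Qed.

Let dot_bracket j l g : test_function g ->
  << Z j l g, Z j l g >> =
  << VU l (VU j g), VU l (VU j g) >> - << VU l (VU l g), VU j (VU j g) >>.
Proof.
move=> tg; have tVjl := tV j (tV l tg); have tVlj := tV l (tV j tg).
have := dot_cross j l tg.
rewrite {1}/Z /bracket (dotBl mu tVjl tVlj (test_smooth (tZ j l tg))).
rewrite (dotBr mu tVjl (test_smooth tVjl) (test_smooth tVlj)).
rewrite (dotBr mu tVlj (test_smooth tVjl) (test_smooth tVlj)).
by rewrite (dotC mu (VU l (VU j g)) (VU j (VU l g))); lra.
Qed.

Lemma test_frakL g : test_function g -> test_function (frakL X U g).
Proof.
move=> tg; have := testZ (-1) (test_sum (index_enum 'I_k)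
  (fun j => tV j (tV j tg))); congr test_function.
by apply/funext => x; rewrite mulN1r.
Qed.

Lemma dot_frakL g h : test_function g -> smooth h ->
  << frakL X U g, h >> = - \sum_j << VU j (VU j g), h >>.
Proof.
move=> tg sh; rewrite -(dot_suml mu _ (fun j => tV j (tV j tg)) sh).
exact: (dotNl mu (test_sum _ (fun j => tV j (tV j tg))) sh).
Qed.

Lemma test_Theta g : test_function g -> test_function (Theta X U g).
Proof.
move=> tg; apply: testB (test_frakL tg) _.
by do 2 (apply: test_sum => ?); do 2 apply: tZ.
Qed.

(** The key estimate: since the brackets commute with the V_j, the sum of the
    squared norms of the [V_j, V_l] g is the sum of the squared norms of the
    V_j V_l g minus |L g|^2, where L = frakL. This loss compensates the
    first-order part (g, L g) <= (|g|^2 + |L g|^2) / 2. *)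
Lemma quadratic_form_le g : test_function g ->
  << g, g \+ Theta X U g >> <=
  3 / 2 * << g, g >> + \sum_j \sum_l << VU j (VU l g), VU j (VU l g) >>.
Proof.
move=> tg; have sg := test_smooth tg.
set L := frakL X U g; have tL : test_function L := test_frakL tg.
have tZZ j l : test_function (Z j l (Z j l g)) := tZ j l (tZ j l tg).
pose S x := \sum_j \sum_l Z j l (Z j l g) x.
have tS : test_function S by do 2 (apply: test_sum => ?); exact: tZZ.
have QE : << g, g \+ Theta X U g >> = << g, g >> + << g, L >> - << g, S >>.
  rewrite dotC [<< g, L >>]dotC [<< g, S >>]dotC.
  rewrite (dotDl mu tg (test_Theta tg) sg) -addrA; congr (_ + _).
  exact: dotBl tL tS sg.
have SE : << g, S >> = - \sum_j \sum_l << Z j l g, Z j l g >>.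
  rewrite dotC (dot_suml mu _ (fun j => test_sum _ (tZZ j)) sg) -sumrN.
  apply: eq_bigr => j _; rewrite (dot_suml mu _ (tZZ j) sg) -sumrN.
  apply: eq_bigr => l _; exact: bracket_skew (tZ j l tg) sg.
have LE : << L, L >> = \sum_j \sum_l << VU l (VU l g), VU j (VU j g) >>.
  rewrite (dot_frakL tg (test_smooth tL)) -sumrN; apply: eq_bigr => j _.
  have tVV := tV j (tV j tg).
  rewrite dotC (dot_frakL tg (test_smooth tVV)) opprK.
  by [].
have zE : \sum_j \sum_l << Z j l g, Z j l g >> =
    \sum_j \sum_l << VU j (VU l g), VU j (VU l g) >> - << L, L >>.
  rewrite LE [X in _ = X - _]exchange_big -sumrB; apply: eq_bigr => j _.
  by rewrite -sumrB; apply: eq_bigr => l _; exact: dot_bracket.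
have gL : 2 * << g, L >> <= << g, g >> + << L, L >>.
  have := dot_ge0 mu (g \- L).
  rewrite (dotBl mu tg tL (test_smooth (testB tg tL))).
  rewrite (dotBr mu tg sg (test_smooth tL)) (dotBr mu tL sg (test_smooth tL)).
  by rewrite (dotC mu L g); lra.
by have := dot_ge0 mu L; rewrite QE SE opprK zE; lra.
Qed.

End QuadraticForm.

(** * Square integrable functions *)

Section L2Functions.
Context d (T : measurableType d) (R : realType) (mu : {measure set T -> \bar R}).
Implicit Types (f g h : T -> R).

Lemma L2_measurable f : L2 mu f -> measurable_fun setT f.
Proof. by rewrite /L2 inE => /andP[]; rewrite inE. Qed.

Lemma L2_integrableM f g : L2 mu f -> L2 mu g ->
  mu.-integrable setT (EFin \o (fun x => f x * g x)).
Proof. by move=> lf lg; apply/Lfun1_integrable; exact: Lfun2_mul_Lfun1. Qed.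

Lemma L2_sub f g : L2 mu f -> L2 mu g -> L2 mu (f \- g).
Proof.
move=> lf lg; have p1 : (1 <= (2%:E : \bar R))%E by rewrite lee_fin ler1n.
have [_ add] := Lfun_addr_closed mu p1.
exact: (add f (- g) lf (Lfun_oppr_closed lg)).
Qed.

Lemma norm2_ge0 f : 0 <= norm2 mu f.
Proof. by rewrite /norm2 fine_ge0// Lnorm_ge0. Qed.

Lemma norm2_sqr f : L2 mu f -> norm2 mu f ^+ 2 = dot mu f f.
Proof.
move=> lf; have fin : 'N[mu]_2%:E[EFin \o f]%E \is a fin_num.
  move: lf; rewrite /L2 inE => /andP[_]; rewrite inE /= /finite_norm => lt.
  by rewrite ge0_fin_numE// Lnorm_ge0.
set N := norm2 mu f; have NE : 'N[mu]_2%:E[EFin \o f]%E = N%:E.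
  by rewrite /N /norm2 fineK.
have := @powR_Lnorm _ _ _ mu (EFin \o f) 2 (lt0r_neq0 (ltr0Sn R 1)).
rewrite NE poweR_EFin powR_mulrn ?norm2_ge0// => N2.
rewrite /dot /Rintegral -[LHS]/(fine (N ^+ 2)%:E) N2; congr fine.
by apply: eq_integral => x _ /=; rewrite powR_mulrn// -normrX ger0_norm ?sqr_ge0// expr2.
Qed.

Lemma dot_Cauchy_Schwarz f g : L2 mu f -> L2 mu g ->
  dot mu f g ^+ 2 <= dot mu f f * dot mu g g.
Proof.
move=> lf lg.
have pos (t : R) : 0 <= t ^+ 2 * dot mu f f - 2 * t * dot mu f g + dot mu g g.
  have iff := L2_integrableM lf lf; have ifg := L2_integrableM lf lg.
  have igg := L2_integrableM lg lg.
  have : 0 <= \int[mu]_x ((t * f x - g x) ^+ 2).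
    by apply: Rintegral_ge0 => x _; exact: sqr_ge0.
  have -> : \int[mu]_x ((t * f x - g x) ^+ 2) =
     \int[mu]_x ((t ^+ 2 * (f x * f x) - 2 * t * (f x * g x)) + g x * g x).
    by apply: eq_Rintegral => x _; ring.
  have i1 : mu.-integrable setT (EFin \o (fun x => t ^+ 2 * (f x * f x))).
    by apply: (integrableZl measurableT (t ^+ 2) iff).
  have i2 : mu.-integrable setT (EFin \o (fun x => 2 * t * (f x * g x))).
    by apply: (integrableZl measurableT (2 * t) ifg).
  rewrite (RintegralD measurableT (integrableB measurableT i1 i2) igg).
  rewrite (RintegralB measurableT i1 i2).
  by rewrite (RintegralZl _ measurableT iff) (RintegralZl _ measurableT ifg).
set a := dot mu f f in pos *; set b := dot mu f g in pos *.
set c := dot mu g g in pos *.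
have a0 : 0 <= a by apply: Rintegral_ge0 => x _; rewrite -expr2 sqr_ge0.
have [a_0|an0] := eqVneq a 0.
  rewrite a_0 in pos *; have [->|bn0] := eqVneq b 0; first by rewrite expr0n mul0r.
  have := pos ((c + 1) / (2 * b)).
  have -> : 2 * ((c + 1) / (2 * b)) * b = c + 1 by field.
  by rewrite mulr0; lra.
have agt0 : 0 < a by rewrite lt0r an0.
have := pos (b / a).
have -> : (b / a) ^+ 2 * a - 2 * (b / a) * b + c = (a * c - b ^+ 2) / a by field.
by rewrite pmulr_lge0 ?invr_gt0// subr_ge0.
Qed.

End L2Functions.

(** * Estimates for truncated functions *)

Section CutoffEstimates.
Context (R : realType) (n : nat) (G : lieGroupType R n).
Context (lambda : {measure set (borel G) -> \bar R}).
Hypothesis lambda_haar : haar_measure lambda.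
Context (k : nat) (X : 'I_k -> operator G).
Hypothesis X_inv : forall j, left_invariant_field (X j).
Context (U : G -> R).
Hypothesis U_smooth : smooth U.
Context (mu : probability (borel G) R).
Hypothesis muE : forall A : set (borel G), measurable A ->
  mu A = (\int[lambda]_(x in A) (expR (- U x))%:E)%E.

Let vX j : vector_field (X j) := (X_inv j).1.

Local Notation VU := (V X U).
Local Notation "<< f , g >>" := (dot mu f g).

Let tV j g : test_function g -> test_function (VU j g) :=
  @V_test _ _ _ _ _ X_inv _ U_smooth j g.
Let sV j g : smooth g -> smooth (VU j g) :=
  @V_smooth _ _ _ _ _ X_inv _ U_smooth j g.

(** The first derivatives of f are square integrable near the set chi = 1, with
    a bound that does not depend on the support of chi. This follows from
    (chi^2 V_l f, V_l f) = - (chi^2 V_l^2 f, f) - 2 (chi (X_l chi) V_l f, f). *)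
Lemma cutoff_energy_le (f chi : G -> R) (l : 'I_k) (C : R) :
  smooth f -> L2 mu f -> L2 mu (VU l (VU l f)) -> test_function chi ->
  (forall x, 0 <= chi x <= 1) -> (forall x, `|X l chi x| <= C) ->
  << chi \* VU l f, chi \* VU l f >> <=
  << VU l (VU l f), VU l (VU l f) >> + (1 + 4 * C ^+ 2) * << f, f >>.
Proof.
move=> sf lf lVV tc c01 XC.
set u := VU l f; set a := VU l u in lVV *.
have su : smooth u := sV l sf.
have sc := test_smooth tc; have sXc := field_smooth (vX l) sc.
have tcu : test_function (chi \* u) := testM tc su.
set s := << _, _ >>.
pose w := (chi \* chi) \* u.
have tw : test_function w := testM (testM tc sc) su.
pose F x := - (chi x ^+ 2 * a x * f x + 2 * (chi x * u x) * (X l chi x * f x)).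
have sE : s = \int[mu]_x F x.
  transitivity << w, u >>.
    by apply: eq_Rintegral => x _; rewrite /w /=; ring.
  have -> : << w, u >> = - << VU l w, f >>.
    by rewrite (V_skew lambda_haar X_inv U_smooth muE l tw sf) opprK.
  rewrite -(dotNl mu (tV l tw) sf); apply: eq_Rintegral => x _.
  rewrite /F /w (V_Leibniz X_inv U l (smoothM sc sc) su) /=.
  by rewrite (fieldM x (vX l) sc sc) -/a; ring.
have C0 x : (X l chi x) ^+ 2 <= C ^+ 2.
  rewrite -(real_normK (num_real (X l chi x))) lerXn2r ?nnegrE//.
  exact: le_trans (normr_ge0 _) (XC x).
have iaa := L2_integrableM lVV lVV; have iff := L2_integrableM lf lf.
have icu : mu.-integrable setT (EFin \o (fun x : borel G => (chi x * u x) * (chi x * u x))).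
  exact: test_mu_integrable (testM tcu (test_smooth tcu)).
have i1 := integrableZl measurableT (2^-1) iaa.
have i2 := integrableZl measurableT (2^-1 + 2 * C ^+ 2) iff.
have i3 := integrableZl measurableT (2^-1) icu.
have ile : \int[mu]_x F x <=
  \int[mu]_x (2^-1 * (a x * a x) + (2^-1 + 2 * C ^+ 2) * (f x * f x) +
    2^-1 * ((chi x * u x) * (chi x * u x))).
  apply: le_Rintegral => //.
  - have tF : test_function F.
      have sa : smooth a := sV l su.
      have t1 := testM (testM (testM tc sc) sa) sf.
      have t2 := testM (testZ 2 tcu) (smoothM sXc sf).
      have := testZ (-1) (testD t1 t2); congr test_function.
      by apply/funext => x; rewrite /F /= mulN1r expr2.
    exact: test_mu_integrable tF.
  - have i := integrableD measurableT (integrableD measurableT i1 i2) i3.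
    exact: i.
  move=> x _; rewrite /F; have := C0 x; have /andP[c0 c1] := c01 x.
  set t := chi x in c0 c1 *; set b := X l chi x => b2.
  set p := a x; set q := f x; set v := u x.
  have t2 : 0 <= t ^+ 2 <= 1 by rewrite sqr_ge0/= expr_le1.
  have h1 : - (t ^+ 2 * p * q) <= 2^-1 * (p * p) + 2^-1 * (q * q).
    have : 0 <= (1 - t ^+ 2) * (p * p + q * q) + t ^+ 2 * ((p + q) * (p + q)).
      rewrite addr_ge0// mulr_ge0//; try by case/andP: t2; lra.
        by rewrite addr_ge0// -expr2 sqr_ge0.
      by rewrite -expr2 sqr_ge0.
    lra.
  have h2 : - (2 * (t * v) * (b * q)) <= 2 * C ^+ 2 * (q * q) + 2^-1 * ((t * v) * (t * v)).
    have h3 : 0 <= (t * v + 2 * (b * q)) ^+ 2 by exact: sqr_ge0.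
    have h4 : b ^+ 2 * (q * q) <= C ^+ 2 * (q * q).
      by apply: ler_wpM2r => //; rewrite -expr2 sqr_ge0.
    lra.
  lra.
rewrite -sE in ile.
move: ile; rewrite (RintegralD measurableT (integrableD measurableT i1 i2) i3).
rewrite (RintegralD measurableT i1 i2).
rewrite (RintegralZl _ measurableT iaa) (RintegralZl _ measurableT iff).
rewrite (RintegralZl _ measurableT icu) -/(dot mu a a) -/(dot mu f f).
rewrite -[\int[mu]_x (chi x * u x * (chi x * u x))]/s; lra.
Qed.

Lemma V_add j f g : smooth f -> smooth g -> VU j (f \+ g) = VU j f \+ VU j g.
Proof.
move=> sf sg; apply/funext => x.
by rewrite /V /= (fieldD x (vX j) sf sg); ring.
Qed.

(** Leibniz formula: V_j V_l (chi f) is chi V_j V_l f up to terms of size e, in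
    which the first derivatives of f only occur where chi' = 1. The factors
    come from (a + b + c + d)^2 <= 2 a^2 + 6 (b^2 + c^2 + d^2). *)
Lemma cutoff_second_derivative_le (f chi chi' : G -> R) (j l : 'I_k) (e : R) :
  smooth f -> L2 mu f -> L2 mu (VU j (VU l f)) ->
  test_function chi -> test_function chi' -> (forall x, 0 <= chi x <= 1) ->
  (forall i x, `|X i chi x| <= e) -> (forall x, `|X j (X l chi) x| <= e) ->
  (forall i x, X i chi x != 0 -> chi' x = 1) ->
  << VU j (VU l (chi \* f)), VU j (VU l (chi \* f)) >> <=
  2 * << VU j (VU l f), VU j (VU l f) >> +
  6 * e ^+ 2 * (<< chi' \* VU l f, chi' \* VU l f >> +
    << chi' \* VU j f, chi' \* VU j f >> + << f, f >>).
Proof.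
move=> sf lf lVV tc tc' c01 Xe XXe X1.
have sc := test_smooth tc.
have tu i : test_function (chi' \* VU i f) := testM tc' (sV i sf).
have E : VU j (VU l (chi \* f)) = fun x => chi x * VU j (VU l f) x +
    X j chi x * VU l f x + X l chi x * VU j f x + X j (X l chi) x * f x.
  rewrite (V_Leibniz X_inv U l sc sf).
  rewrite (V_add j (smoothM sc (sV l sf)) (smoothM (field_smooth (vX l) sc) sf)).
  rewrite (V_Leibniz X_inv U j sc (sV l sf)).
  rewrite (V_Leibniz X_inv U j (field_smooth (vX l) sc) sf).
  by apply/funext => x /=; ring.
have tVV := tV j (tV l (testM tc sf)).
have iVV := L2_integrableM lVV lVV; have iff := L2_integrableM lf lf.
have iu i := test_mu_integrable mu (testM (tu i) (test_smooth (tu i))).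
have i1 := integrableZl measurableT 2 iVV.
have i23 := integrableD measurableT (integrableD measurableT (iu l) (iu j)) iff.
have i4 := integrableZl measurableT (6 * e ^+ 2) i23.
have ile : << VU j (VU l (chi \* f)), VU j (VU l (chi \* f)) >> <=
  \int[mu]_x (2 * (VU j (VU l f) x * VU j (VU l f) x) + 6 * e ^+ 2 *
    ((chi' \* VU l f) x * (chi' \* VU l f) x +
     (chi' \* VU j f) x * (chi' \* VU j f) x + f x * f x)).
  apply: le_Rintegral => //.
  - exact: test_mu_integrable (testM tVV (test_smooth tVV)).
  - have i := integrableD measurableT i1 i4.
    exact: i.
  move=> x _; rewrite E /=.
  have sqr_le (b : R) : `|b| <= e -> b ^+ 2 <= e ^+ 2.
    move=> be; rewrite -(real_normK (num_real b)) lerXn2r ?nnegrE//.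
    exact: le_trans (normr_ge0 _) be.
  have term i (v : R) : (X i chi x * v) ^+ 2 <= e ^+ 2 * (chi' x * v) ^+ 2.
    have [->|Xn0] := eqVneq (X i chi x) 0.
      by rewrite mul0r expr0n/= mulr_ge0 ?sqr_ge0.
    rewrite (X1 _ _ Xn0) mul1r exprMn; apply: ler_wpM2r; first exact: sqr_ge0.
    exact: sqr_le.
  have := term j (VU l f x); have := term l (VU j f x).
  have : (X j (X l chi) x * f x) ^+ 2 <= e ^+ 2 * f x ^+ 2.
    by rewrite exprMn; apply: ler_wpM2r; [exact: sqr_ge0|exact: sqr_le].
  set p := chi x; set a := VU j (VU l f) x.
  have : (p * a) ^+ 2 <= a ^+ 2.
    have /andP[p0 p1] := c01 x.
    by rewrite exprMn ler_piMl ?sqr_ge0// expr_le1.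
  set b := X j chi x * _; set c := X l chi x * _; set d := X j _ x * _.
  move=> h1 h2 h3 h4.
  have h5 : 0 <= (p * a - b - c - d) ^+ 2 by exact: sqr_ge0.
  have h6 := sqr_ge0 (b - c); have h7 := sqr_ge0 (b - d); have h8 := sqr_ge0 (c - d).
  lra.
move: ile; rewrite (RintegralD measurableT i1 i4).
rewrite (RintegralZl _ measurableT iVV) (RintegralZl _ measurableT i23).
rewrite (RintegralD measurableT (integrableD measurableT (iu l) (iu j)) iff).
by rewrite (RintegralD measurableT (iu l) (iu j)).
Qed.

End CutoffEstimates.

(** * Passage to the limit *)

Section WeakLimit.
Context d (T : measurableType d) (R : realType) (mu : {measure set T -> \bar R}).
Implicit Types (f q : T -> R).

Lemma dot_cutoff_cvg f q (chi : nat -> T -> R) : L2 mu f -> L2 mu q ->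
  (forall m, measurable_fun setT (chi m)) -> (forall m x, 0 <= chi m x <= 1) ->
  (forall x, exists M, forall m, (M <= m)%N -> chi m x = 1) ->
  dot mu (chi m \* f) q @[m --> \oo] --> dot mu f q.
Proof.
move=> lf lq mchi c01 c1.
have ifq := L2_integrableM lf lq.
have mf := L2_measurable lf; have mq := L2_measurable lq.
have [] := @dominated_convergence _ _ R mu setT measurableT
  (fun m x => (chi m x * f x * q x)%:E) (fun x => (f x * q x)%:E)
  (fun x => `|f x * q x|%:E).
- move=> m; apply/measurable_EFinP; apply: measurable_funM => //.
  exact: measurable_funM.
- by apply/measurable_EFinP; exact: measurable_funM.
- apply: aeW => x _; apply: cvg_near_cst; have [M HM] := c1 x.
  by exists M => // m /= Mm; rewrite HM// mul1r.
- exact: integrable_abse ifq.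
- apply: aeW => x m _; rewrite lee_fin -mulrA normrM ler_piMl//.
  by have /andP[c0 c1'] := c01 m x; rewrite ger0_norm.
move=> _ _ cv; apply: fine_cvg; rewrite fineK; first exact: cv.
exact: integrable_fin_num ifq.
Qed.

(** A vector w whose scalar products with a dense set of vectors p are bounded
    by B^(1/2) |p| has squared norm at most B. *)
Lemma dense_norm_le (w : T -> R) (B : R) (D : (T -> R) -> Prop) : L2 mu w ->
  0 <= B ->
  (forall e : R, 0 < e -> exists p, [/\ L2 mu p, D p & norm2 mu (w \- p) < e]) ->
  (forall p, D p -> L2 mu p -> dot mu w p ^+ 2 <= B * dot mu p p) ->
  dot mu w w <= B.
Proof.
move=> lw B0 dense bound; rewrite leNgt; apply/negP => Blt.
set ww := dot mu w w in Blt *; pose g := ww - B.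
have g0 : 0 < g by rewrite subr_gt0.
have ww0 : 0 < ww by exact: le_lt_trans B0 Blt.
have gw : g <= ww by rewrite /g; lra.
pose W := norm2 mu w.
have WE : W ^+ 2 = ww by exact: norm2_sqr.
have W0 : 0 < W by rewrite lt0r norm2_ge0 andbT -sqrf_eq0 WE gt_eqF.
(* With r = w - p, this choice gives |(w, r)| <= g / 4 and B (r, r) <= g^2 / 16. *)
pose e := W * g / (4 * ww).
have e0 : 0 < e by rewrite /e divr_gt0 ?mulr_gt0.
have [p [lp Dp wp]] := dense e e0.
pose r := w \- p; have lr : L2 mu r by exact: L2_sub.
have iww := L2_integrableM lw lw; have iwr := L2_integrableM lw lr.
have irr := L2_integrableM lr lr.
set rr := dot mu r r; set wr := dot mu w r.
have wpE : dot mu w p = ww - wr.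
  rewrite /ww /wr /dot -(RintegralB measurableT iww iwr).
  by apply: eq_Rintegral => x _; rewrite /r /=; ring.
have ppE : dot mu p p = ww - 2 * wr + rr.
  have i2 := integrableZl measurableT 2 iwr.
  rewrite /ww /wr /rr /dot -(RintegralZl _ measurableT iwr).
  rewrite -(RintegralB measurableT iww i2).
  rewrite -(RintegralD measurableT (integrableB measurableT iww i2) irr).
  by apply: eq_Rintegral => x _; rewrite /r /=; ring.
have rre : rr <= g ^+ 2 / (16 * ww).
  have -> : g ^+ 2 / (16 * ww) = e ^+ 2.
    by rewrite /e !exprMn WE; field; rewrite gt_eqF.
  by rewrite /rr -norm2_sqr// lerXn2r ?nnegrE ?norm2_ge0// ltW.
have wr2 : wr ^+ 2 <= (g / 4) ^+ 2.
  apply: le_trans (dot_Cauchy_Schwarz lw lr) _; rewrite -/ww -/rr.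
  apply: le_trans (ler_wpM2l (ltW ww0) rre) _.
  rewrite le_eqVlt; apply/orP; left; apply/eqP; field; rewrite gt_eqF//.
have wr1 : wr <= g / 4.
  rewrite (le_trans (ler_norm _))// -(@ler_pXn2r _ 2) ?nnegrE ?divr_ge0 ?(ltW g0)//.
  by rewrite real_normK ?num_real.
have := bound p Dp lp; rewrite wpE ppE => H.
have Br : B * rr <= g ^+ 2 / 16.
  apply: (@le_trans _ _ (ww * rr)).
    by apply: ler_wpM2r; [apply: Rintegral_ge0 => x _; rewrite -expr2 sqr_ge0|exact: ltW].
  apply: le_trans (ler_wpM2l (ltW ww0) rre) _.
  rewrite le_eqVlt; apply/orP; left; apply/eqP; field; rewrite gt_eqF//.
have h1 : g * ww <= 2 * (g * wr) + B * rr.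
  have := sqr_ge0 wr; rewrite /g; lra.
have h2 : g * wr <= g * (g / 4) by apply: ler_wpM2l => //; exact: ltW.
have h3 : g * g <= g * ww by apply: ler_wpM2l => //; exact: ltW.
have h4 : 0 < g * g by exact: mulr_gt0.
lra.
Qed.

End WeakLimit.

(** * The estimate for the square root of 1 + Theta *)

(** The quadratic form of 1 + Theta on the truncations chi_m f of f. *)
Lemma truncated_form_le (R : realType) (n : nat) (G : lieGroupType R n)
    (Gconn : connected [set: G])
    (k : nat) (X : 'I_k -> operator G)
    (X_inv : forall j, left_invariant_field (X j))
    (lambda : {measure set (borel G) -> \bar R})
    (lambda_haar : haar_measure lambda)
    (U : G -> R) (U_smooth : smooth U)
    (mu : probability (borel G) R)
    (muE : forall A : set (borel G), measurable A ->
       mu A = (\int[lambda]_(x in A) (expR (- U x))%:E)%E)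
    (order2 : lie_nilpotent_of_order G 2)
    (f : G -> R) (f_smooth : smooth f) (f_L2 : L2 mu f)
    (VVf_L2 : forall j l, L2 mu (V X U j (V X U l f))) :
  exists (D : R) (chi : nat -> G -> R), [/\ forall m, test_function (chi m),
    forall m x, 0 <= chi m x <= 1,
    forall x, exists M, forall m, (M <= m)%N -> chi m x = 1
    & forall m, dot mu (chi m \* f) ((chi m \* f) \+ Theta X U (chi m \* f)) <=
      2 * (\sum_(j < k) \sum_(l < k)
         dot mu (V X U j (V X U l f)) (V X U j (V X U l f)) + dot mu f f) +
      D / m.+1%:R].
Proof.
have [C [chi [C0 tchi chi01 chi1 [Xchi XXchi next]]]] := cutoff_sequence X_inv Gconn.
set N := dot mu f f.
have N0 : 0 <= N := dot_ge0 mu f.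
pose E l := dot mu (V X U l (V X U l f)) (V X U l (V X U l f)) + (1 + 4 * C ^+ 2) * N.
have CC : 0 <= 4 * C ^+ 2 by rewrite mulr_ge0 ?sqr_ge0.
have E0 l : 0 <= E l by rewrite addr_ge0 ?dot_ge0// mulr_ge0// addr_ge0.
have Cm m : C / m.+1%:R <= C by rewrite ler_pdivrMr// ler_peMr// ler1n.
have energy m l : dot mu (chi m \* V X U l f) (chi m \* V X U l f) <= E l.
  apply: (cutoff_energy_le lambda_haar X_inv U_smooth muE f_smooth f_L2
    (VVf_L2 l l) (tchi m) (chi01 m)) => x.
  exact: le_trans (Xchi m l x) (Cm m).
pose D := C ^+ 2 * \sum_(j < k) \sum_(l < k) (6 * (E l + E j + N)).
exists D, chi; split=> // m.
have [m' chim'] := next m.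
set e := C / m.+1%:R.
have second j l : dot mu (V X U j (V X U l (chi m \* f))) (V X U j (V X U l (chi m \* f))) <=
    2 * dot mu (V X U j (V X U l f)) (V X U j (V X U l f)) +
    e ^+ 2 * (6 * (E l + E j + N)).
  have := cutoff_second_derivative_le X_inv U_smooth f_smooth f_L2 (VVf_L2 j l)
    (tchi m) (tchi m') (chi01 m) (Xchi m) (XXchi m j l) chim'.
  move=> /le_trans; apply; rewrite lerD2l -/e.
  rewrite (_ : 6 * e ^+ 2 * _ = e ^+ 2 * (6 * (dot mu (chi m' \* V X U l f) (chi m' \* V X U l f) +
    dot mu (chi m' \* V X U j f) (chi m' \* V X U j f) + N))); last by rewrite /N; ring.
  apply: ler_wpM2l; first exact: sqr_ge0.
  apply: ler_wpM2l => //; rewrite lerD2r.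
  exact: lerD (energy m' l) (energy m' j).
have tcf := testM (tchi m) f_smooth.
have cfN : dot mu (chi m \* f) (chi m \* f) <= N.
  apply: le_Rintegral => //.
  - exact: test_mu_integrable (testM tcf (test_smooth tcf)).
  - exact: (L2_integrableM f_L2 f_L2).
  move=> x _ /=; have /andP[c0 c1] := chi01 m x.
  rewrite (_ : _ * _ = chi m x ^+ 2 * f x ^+ 2); last by ring.
  by rewrite -expr2 ler_piMl ?sqr_ge0// expr_le1.
have e2 : e ^+ 2 <= C ^+ 2 / m.+1%:R.
  rewrite /e expr_div_n ler_wpM2l ?sqr_ge0// lef_pV2 ?posrE ?exprn_gt0//.
  by rewrite expr2 ler_peMr// ler1n.
apply: le_trans (quadratic_form_le lambda_haar X_inv U_smooth muE order2 tcf) _.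
have sum_le : \sum_(j < k) \sum_(l < k)
    dot mu (V X U j (V X U l (chi m \* f))) (V X U j (V X U l (chi m \* f))) <=
  2 * (\sum_(j < k) \sum_(l < k)
         dot mu (V X U j (V X U l f)) (V X U j (V X U l f))) +
  e ^+ 2 * \sum_(j < k) \sum_(l < k) (6 * (E l + E j + N)).
  rewrite !mulr_sumr -big_split; apply: ler_sum => j _ /=.
  by rewrite !mulr_sumr -big_split; apply: ler_sum => l _ /=; exact: second.
have DE : e ^+ 2 * \sum_(j < k) \sum_(l < k) (6 * (E l + E j + N)) <= D / m.+1%:R.
  rewrite /D [leRHS]mulrAC; apply: (ler_wpM2r _ e2).
  do 2 (apply: sumr_ge0 => ? _); by rewrite mulr_ge0// addr_ge0// addr_ge0.
apply: le_trans (lerD (ler_wpM2l _ cfN) (le_trans sum_le (lerD (lexx _) DE))) _ => //.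
rewrite -/N mulrDr; move: (D / _) (\sum_j _) => r A; lra.
Qed.

Theorem proposition10 (R : realType) (n : nat) (G : lieGroupType R n)
    (Gnil : nilpotent_lie_group G)
    (k : nat) (X : 'I_k -> operator G)
    (X_inv : forall j, left_invariant_field (X j))
    (X_gen : lie_generates X)
    (lambda : {measure set (borel G) -> \bar R})
    (lambda_haar : haar_measure lambda)
    (U : G -> R) (U_smooth : smooth U)
    (mu : probability (borel G) R)
    (muE : forall A : set (borel G), measurable A ->
       mu A = (\int[lambda]_(x in A) (expR (- U x))%:E)%E)
    (order2 : lie_nilpotent_of_order G 2)
    (Theta_op Lambda1 : L2_operator (borel G) R)
    (Theta_opP : realizes mu (Theta X U) Theta_op)
    (Lambda1P : is_sqrt_op mu Lambda1 (one_plus Theta_op))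
    (f : G -> R) (f_smooth : smooth f) (f_L2 : L2 mu f)
    (VVf_L2 : forall j l, L2 mu (V X U j (V X U l f)))
    (Lambda1_f : G -> R) (f_dom : Lambda1 f Lambda1_f) :
  norm2 mu Lambda1_f ^+ 2 <=
  2 * (\sum_(j < k) \sum_(l < k)
         dot mu (V X U j (V X U l f)) (V X U j (V X U l f))
       + norm2 mu f ^+ 2).
Proof.
have [D [chi [tchi chi01 chi1 QB]]] := truncated_form_le Gnil.1 X_inv lambda_haar U_smooth
  muE order2 f_smooth f_L2 VVf_L2.
set A := \sum_(j < k) _ in QB *; set N := dot mu f f in QB.
have A0 : 0 <= A by do 2 (apply: sumr_ge0 => ? _); exact: dot_ge0.
have N0 : 0 <= N := dot_ge0 mu f.
have [[dense adj] _ sqr] := Lambda1P.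
have [_ _ act] := Theta_opP.
have [_ lw symf] := (adj f Lambda1_f).1 f_dom.
rewrite (norm2_sqr lw) (norm2_sqr f_L2) -/N.
apply: (@dense_norm_le _ _ _ mu _ _ (fun p => exists q, Lambda1 p q)) => //.
- by rewrite mulr_ge0// addr_ge0.
- move=> e e0; have [p [q [lp pq wp]]] := dense _ lw _ e0.
  by exists p; split=> //; exists q.
move=> p [q pq] lp; have [_ lq _] := (adj p q).1 pq.
(* h = Lambda1 (chi_m f) *)
have approx m : exists h, [/\ L2 mu h, dot mu h p = dot mu (chi m \* f) q &
    dot mu h h <= 2 * (A + N) + D / m.+1%:R].
  have tcf := testM (tchi m) f_smooth.
  have [h cfh hcf] := (sqr (chi m \* f) ((chi m \* f) \+ Theta X U (chi m \* f))).2
    (ex_intro2 _ _ _ (act _ tcf) erefl).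
  have [_ lh symh] := (adj _ _).1 cfh; exists h; split => //.
    exact: symh.
  have [_ _ symk] := (adj _ _).1 hcf.
  by rewrite -(symk _ _ cfh) dotC; exact: QB.
rewrite (symf _ _ pq).
have cv : dot mu (chi m \* f) q @[m --> \oo] --> dot mu f q.
  apply: dot_cutoff_cvg => // m.
  exact: continuous_borel_measurable (smooth_continuous (test_smooth (tchi m))).
have cvB : (2 * (A + N) + D / m.+1%:R) * dot mu p p @[m --> \oo] -->
    2 * (A + N) * dot mu p p.
  apply: cvgM; last exact: cvg_cst.
  rewrite -[X in _ --> X]addr0; apply: cvgD; first exact: cvg_cst.
  rewrite -[X in _ --> X](mulr0 D); apply: cvgMl_tmp; exact: (@cvg_harmonic R).
apply: ler_cvg_to (cvgM cv cv) cvB _; apply: nearW => m.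
have [h [lh hp hB]] := approx m.
rewrite /= -expr2 -hp; apply: le_trans (dot_Cauchy_Schwarz lh lp) _.
apply: ler_wpM2r hB; exact: dot_ge0.
Qed.
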